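(* Let $\boldsymbol\mu=\{\mu_\beta\}_{|\beta|\ge1}$ be a weight sequence with the property that $\mathcal D(\boldsymbol\mu)$ contains a neighborhood of the origin and let $W=(W_1,\ldots,W_n)$ be the associated weighted left multi-shift. If $J_c$ is the $w^*$-closed two-sided ideal of the Hardy algebra $F^\infty(\boldsymbol\mu)$ generated by the commutators $W_iW_j-W_jW_i$, $i,j\in\{1,\ldots,n\}$, then the following statements hold. (i) $F_s^2(\boldsymbol\mu)=\overline{\mathrm{span}}\{z_\lambda:\lambda\in\mathcal D(\boldsymbol\mu)\}=F^2(H_n)\ominus\overline{J_c(1)}$. (ii) The symmetric weighted Fock space $F_s^2(\boldsymbol\mu)$ can be identified with the Hilbert space $\mathbb H^2(\mathcal D(\boldsymbol\mu))$ of all functions $\varphi:\mathcal D(\boldsymbol\mu)\to\mathbb C$ which admit a power series representation $\varphi(\lambda)=\sum_{\mathbf k\in\mathbb N_0^n}c_{\mathbf k}\lambda^{\mathbf k}$ with $$\|\varphi\|_2^2=\sum_{\mathbf k\in\mathbb N_0^n}|c_{\mathbf k}|^2\frac1{\omega_{\mathbf k}}<\infty.$$ More precisely, every element $\varphi=\sum_{\mathbf k\in\mathbb N_0^n}c_{\mathbf k}y^{(\mathbf k)}$ in $F_s^2(\boldsymbol\mu)$ has a functional representation on $\mathcal D(\boldsymbol\mu)$ given by $$\varphi(\lambda):=\langle\varphi,z_\lambda\rangle=\sum_{\mathbf k\in\mathbb N_0^n}c_{\mathbf k}\lambda^{\mathbf k},\qquad\lambda\in\mathcal D(\boldsymbol\mu),$$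 and $$|\varphi(\lambda)|\le\|\varphi\|_2\Big(\sum_{\alpha\in\mathbb F_n^+}\frac{|\lambda_\alpha|^2}{\boldsymbol\mu(\alpha,g_0)^2}\Big)^{1/2},\qquad\lambda\in\mathcal D(\boldsymbol\mu).$$ (iii) $\mathbb H^2(\mathcal D(\boldsymbol\mu))$ is the reproducing kernel Hilbert space with kernel $\boldsymbol\kappa:\mathcal D(\boldsymbol\mu)\times\mathcal D(\boldsymbol\mu)\to\mathbb C$ defined by $$\boldsymbol\kappa(\zeta,\lambda):=\langle z_\lambda,z_\zeta\rangle=\sum_{\beta\in\mathbb F_n^+}\frac1{\boldsymbol\mu(\beta,g_0)^2}\zeta_\beta\overline{\lambda}_\beta,\qquad\lambda,\zeta\in\mathcal D(\boldsymbol\mu).$$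
   Context: $\mathbb F_n^+$ is the unital free semigroup on generators $g_1,\ldots,g_n$ with identity $g_0$; $|\alpha|$ is the length of $\alpha$. $F^2(H_n)$ is the full Fock space, a Hilbert space with orthonormal basis $\{e_\alpha\}_{\alpha\in\mathbb F_n^+}$, $1:=e_{g_0}$. For $\alpha=g_{i_1}\cdots g_{i_k}$: $\lambda_\alpha:=\lambda_{i_1}\cdots\lambda_{i_k}$, $W_\alpha:=W_{i_1}\cdots W_{i_k}$, $\boldsymbol\mu(\alpha,g_0):=\mu_{g_{i_1}\cdots g_{i_k}}\mu_{g_{i_2}\cdots g_{i_k}}\cdots\mu_{g_{i_k}}$; for $g_0$ these are $1$, $I$, $1$. Standing assumptions: $\mu_\beta>0$, and for each $i$, $\sup_\alpha\mu_{g_i\alpha}<\infty$ and $\sup_\alpha\boldsymbol\mu(\alpha g_i,g_0)/\boldsymbol\mu(\alpha,g_0)<\infty$. $W_ie_\alpha:=\mu_{g_i\alpha}e_{g_i\alpha}$. $F^\infty(\boldsymbol\mu)$ is the $w^*$-closed algebra generated by $W_1,\ldots,W_n$ and $I$. $\mathcal D(\boldsymbol\mu):=\{\lambda\in\mathbb C^n:\sum_{\alpha}|\lambda_\alpha|^2/\boldsymbol\mu(\alpha,g_0)^2<\infty\}$, and for $\lambda\in\mathcal D(\boldsymbol\mu)$, $z_\lambda:=\sum_{\alpha}\frac{\bar\lambda_\alpha}{\boldsymbol\mu(\alpha,g_0)}e_\alpha\in F^2(H_n)$. For $\mathbf k=(k_1,\ldots,k_n)\in\mathbb N_0^n$, $\lambda^{\mathbf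 k}:=\lambda_1^{k_1}\cdots\lambda_n^{k_n}$, $\Lambda_{\mathbf k}:=\{\alpha\in\mathbb F_n^+:\lambda_\alpha=\lambda^{\mathbf k}\text{ for all }\lambda\in\mathbb C^n\}$, $\omega_{\mathbf k}:=\sum_{\alpha\in\Lambda_{\mathbf k}}\frac1{\boldsymbol\mu(\alpha,g_0)^2}$, $y^{(\mathbf k)}:=\frac1{\omega_{\mathbf k}}\sum_{\alpha\in\Lambda_{\mathbf k}}\frac1{\boldsymbol\mu(\alpha,g_0)}e_\alpha$. These vectors are orthogonal with $\|y^{(\mathbf k)}\|=\omega_{\mathbf k}^{-1/2}$; the symmetric weighted Fock space $F_s^2(\boldsymbol\mu)$ is their closed linear span. $J_c(1)=\{A1:A\in J_c\}$. In (ii), $\|\cdot\|_2$ applied to elements of $F_s^2(\boldsymbol\mu)$ is the norm of $F^2(H_n)$. *)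

(* Defs.v *)
From HB Require Import structures.
From mathcomp Require Import all_boot all_order all_algebra.
From mathcomp Require Import complex.
From mathcomp Require Import ring lra.
From mathcomp Require Import all_classical all_reals all_analysis.
From mathcomp.analysis.showcase Require Import summability.

Set Implicit Arguments.
Unset Strict Implicit.
Unset Printing Implicit Defensive.

Import Order.TTheory GRing.Theory Num.Theory.
Import numFieldNormedType.Exports.
Import Normc.

Local Open Scope classical_set_scope.
Local Open Scope complex_scope.
Local Open Scope ring_scope.

(* The usual topology of the complex plane; the norm of x : R[i] is (normc x)%:C. *)
HB.instance Definition _ (R : realType) := NormedModule.copy R[i] R[i]^o.

Section ell2_def.
Context (R : realType) (I : choiceType).
Implicit Types f g : I -> R[i].

Definition sqnorm f : \bar R := (\esum_(i in [set: I]) ((normc (f i)) ^+ 2)%:E)%E.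

Definition ell2_pred : {pred I -> R[i]} := fun f => `[< (sqnorm f < +oo)%E >].

Record ell2 := Ell2 { ell2_fun :> I -> R[i]; _ : ell2_fun \in ell2_pred }.

HB.instance Definition _ := [isSub for ell2_fun].
HB.instance Definition _ := [Choice of ell2 by <:].

Lemma sqnorm_ge0 f : (0 <= sqnorm f)%E.
Proof. by apply: esum_ge0 => i _; rewrite lee_fin sqr_ge0. Qed.

Lemma ell2P f : reflect (sqnorm f < +oo)%E (f \in ell2_pred).
Proof. exact: asboolP. Qed.

Lemma ge0_esumZ (k : R) (a : I -> R) : 0 <= k -> (forall i, 0 <= a i) ->
  (\esum_(i in [set: I]) (k * a i)%:E <= k%:E * \esum_(i in [set: I]) (a i)%:E)%E.
Proof.
move=> k0 a0; apply: ge_ereal_sup => _ [X [Xf _]] <-.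
rewrite (_ : (\sum_(x \in X) _)%E = (k%:E * \sum_(x \in X) (a x)%:E)%E).
  by rewrite lee_wpmul2l ?lee_fin//; apply: ereal_sup_ubound; exists X.
by rewrite ge0_mule_fsumr.
Qed.

Lemma sqnormZ (k : R[i]) f : (sqnorm (k *: f) <= ((normc k) ^+ 2)%:E * sqnorm f)%E.
Proof.
apply: le_trans (ge0_esumZ _ _); rewrite ?sqr_ge0//; last by move=> i; rewrite sqr_ge0.
by apply: le_esum => i _; rewrite lee_fin -exprMn -normcM.
Qed.

Lemma normc_ge0 (x : R[i]) : 0 <= normc x.
Proof. by rewrite -lecR; have := normr_ge0 x. Qed.

Lemma sqnormD_weighted (s t : R) f g : 0 <= s -> 0 <= t -> 1 <= s * t ->
  (sqnorm (f + g)%R <= (1 + s)%:E * sqnorm f + (1 + t)%:E * sqnorm g)%E.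
Proof.
move=> s0 t0 st.
have H (k : R) h : 0 <= k -> (\esum_(i in [set: I]) ((1 + k) * normc (h i) ^+ 2)%:E
    <= (1 + k)%:E * sqnorm h)%E.
  by move=> k0; apply: ge0_esumZ => [|i]; rewrite ?sqr_ge0 ?addr_ge0.
apply: le_trans (leeD (H s f s0) (H t g t0)).
rewrite -esumD; last 2 first.
- by move=> i _; rewrite lee_fin mulr_ge0 ?sqr_ge0 ?addr_ge0.
- by move=> i _; rewrite lee_fin mulr_ge0 ?sqr_ge0 ?addr_ge0.
apply: le_esum => i _; rewrite -EFinD lee_fin.
have a0 := normc_ge0 (f i); have b0 := normc_ge0 (g i).
apply: (@le_trans _ _ ((normc (f i) + normc (g i)) ^+ 2)).
  by rewrite lerXn2r ?nnegrE ?addr_ge0 ?normc_ge0// le_normcD.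
set a := normc (f i) in a0 *; set b := normc (g i) in b0 *.
have sp : 0 < s.
  by rewrite lt_def s0 andbT; apply: contraTneq st => ->; rewrite mul0r -ltNge ltr01.
suff : 2 * (a * b) <= s * a ^+ 2 + t * b ^+ 2 by nra.
have h1 : 0 <= (s * a - b) ^+ 2 by rewrite sqr_ge0.
have h2 : 0 <= (s * t - 1) * b ^+ 2 by rewrite mulr_ge0 ?sqr_ge0// subr_ge0.
by rewrite -(ler_pM2l sp); nra.
Qed.

Lemma ell2_submod : submod_closed ell2_pred.
Proof.
split.
  by apply/ell2P; rewrite /sqnorm esum1 ?ltry// => i _; rewrite normc0 expr0n.
move=> k f g /ell2P hf /ell2P hg; apply/ell2P.
have h1 : (sqnorm (k *: f) < +oo)%E.
  apply: le_lt_trans (sqnormZ _ _) _.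
  by rewrite lte_mul_pinfty ?lee_fin ?sqr_ge0.
apply: le_lt_trans (@sqnormD_weighted 1 1 _ _ _ _ _) _ => //; first by rewrite mulr1.
by rewrite lte_add_pinfty// lte_mul_pinfty ?lee_fin.
Qed.

HB.instance Definition _ :=
  GRing.isSubmodClosed.Build R[i] (I -> R[i]) ell2_pred ell2_submod.
HB.instance Definition _ := [SubChoice_isSubLmodule of ell2 by <:].

Implicit Types u v : ell2.

Definition l2norm (u : ell2) : R := Num.sqrt (fine (sqnorm u)).

Lemma sqnorm_fin u : (sqnorm u \is a fin_num)%E.
Proof. by rewrite ge0_fin_numE ?sqnorm_ge0//; apply/ell2P/(valP u). Qed.

Lemma l2norm_sq u : ((l2norm u) ^+ 2)%:E = sqnorm u.
Proof. by rewrite sqr_sqrtr ?fine_ge0 ?sqnorm_ge0// fineK ?sqnorm_fin. Qed.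

Lemma l2norm_ge0 u : 0 <= l2norm u. Proof. exact: sqrtr_ge0. Qed.

Lemma ell2E u v : (forall i, u i = v i) -> u = v.
Proof. by move=> uv; apply/val_inj/funext. Qed.

Lemma ell2DE u v i : (u + v) i = u i + v i. Proof. by []. Qed.

Lemma ell2ZE (k : R[i]) u i : (k *: u) i = k * u i. Proof. by []. Qed.

Lemma l2norm_eq0 u : l2norm u = 0 -> u = 0.
Proof.
move=> u0; apply: ell2E => i; apply: eq0_normc; apply/eqP.
rewrite -sqrf_eq0 eq_le sqr_ge0 andbT -lee_fin.
rewrite (_ : 0%:E = sqnorm u); last by rewrite -l2norm_sq u0 expr0n.
rewrite -(@esum_set1 _ _ i (fun i => (normc (u i) ^+ 2)%:E)) ?lee_fin ?sqr_ge0//.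
rewrite /sqnorm [leRHS](esumID [set i]) => [|j _]; last by rewrite lee_fin sqr_ge0.
rewrite setTI leeDl// esum_ge0// => j _; by rewrite lee_fin sqr_ge0.
Qed.

Lemma l2normD u v : l2norm (u + v) <= l2norm u + l2norm v.
Proof.
have [/l2norm_eq0 ->|u0] := eqVneq (l2norm u) 0.
  by rewrite add0r lerDr l2norm_ge0.
have [/l2norm_eq0 ->|v0] := eqVneq (l2norm v) 0.
  by rewrite addr0 lerDl l2norm_ge0.
have up : 0 < l2norm u by rewrite lt_def u0 l2norm_ge0.
have vp : 0 < l2norm v by rewrite lt_def v0 l2norm_ge0.
rewrite -(@ler_pXn2r _ 2) ?nnegrE ?addr_ge0 ?l2norm_ge0// -lee_fin l2norm_sq.
have := @sqnormD_weighted (l2norm v / l2norm u) (l2norm u / l2norm v) u v.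
move=> /(_ _ _ _)/le_trans; apply; rewrite ?divr_ge0 ?l2norm_ge0//.
  by rewrite mulrA divfK// divff.
rewrite -!l2norm_sq -!EFinM -EFinD lee_fin le_eqVlt; apply/orP; left; apply/eqP.
by field; rewrite u0 v0.
Qed.

Lemma l2normZ (k : R[i]) u : l2norm (k *: u) = normc k * l2norm u.
Proof.
suff H (c : R[i]) w : l2norm (c *: w) <= normc c * l2norm w.
  apply/eqP; rewrite eq_le H/=; have [->|k0] := eqVneq k 0.
    by rewrite normc0 mul0r l2norm_ge0.
  have kp : 0 < normc k by rewrite lt_def normc_ge0 andbT; apply: contra_neq k0 => /eq0_normc.
  rewrite -ler_pdivlMl// -normcV -[X in l2norm X <= _](@scalerK _ _ k)//.
rewrite -(@ler_pXn2r _ 2) ?nnegrE ?mulr_ge0 ?normc_ge0 ?l2norm_ge0// -lee_fin.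
by rewrite l2norm_sq exprMn EFinM l2norm_sq; apply: sqnormZ.
Qed.

Fact ell2_ler_normD u v : (l2norm (u + v))%:C <= (l2norm u)%:C + (l2norm v)%:C.
Proof. by rewrite -rmorphD lecR l2normD. Qed.

Fact ell2_normrZ (k : R[i]) u : (l2norm (k *: u))%:C = `|k| * (l2norm u)%:C.
Proof. by rewrite l2normZ rmorphM. Qed.

Fact ell2_normr0_eq0 u : (l2norm u)%:C = 0 -> u = 0.
Proof. by move=> [] /l2norm_eq0. Qed.

HB.instance Definition _ := Lmodule_isNormed.Build R[i] ell2
  ell2_ler_normD ell2_normrZ ell2_normr0_eq0.

(* Linear in the first argument; the series converges absolutely, so the limit
   [sum] of the net of finite partial sums exists. *)
Definition inner (u v : ell2) : R[i] := sum (fun i => u i * (v i)^*).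

Lemma sqnorm_bound (M : R) f g : 0 <= M ->
  (forall i, normc (f i) <= M * normc (g i)) ->
  (sqnorm f <= (M ^+ 2)%:E * sqnorm g)%E.
Proof.
move=> M0 fg; apply: le_trans (ge0_esumZ _ _); rewrite ?sqr_ge0//; last first.
  by move=> i; rewrite sqr_ge0.
apply: le_esum => i _; rewrite lee_fin -exprMn lerXn2r ?nnegrE ?mulr_ge0 ?normc_ge0//.
Qed.

Fact delta_ell2 (a : I) : (fun i => (i == a)%:R : R[i]) \in ell2_pred.
Proof.
apply/ell2P; rewrite /sqnorm (esumID [set a]) => [|j _]; last by rewrite lee_fin sqr_ge0.
rewrite [X in (_ + X)%E]esum1 => [|i [_ /= /eqP/negbTE ->]]; last by rewrite normc0 expr0n.
by rewrite setTI esum_set1 ?lee_fin ?sqr_ge0// adde0 ltry.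
Qed.

Definition basis (a : I) : ell2 := Ell2 (delta_ell2 a).

Lemma basisE a i : basis a i = (i == a)%:R. Proof. by []. Qed.

End ell2_def.
Arguments inner {R I}.
Arguments basis {R I}.

Section operators.
Context {K : numFieldType} {V : normedModType K}.
Implicit Types (S : set V) (A B : V -> V).

Definition lin_span S : set V :=
  [set v | exists m (c : 'I_m -> K) (u : 'I_m -> V),
    (forall i, S (u i)) /\ v = \sum_i c i *: u i].

Definition closed_span S : set V := closure (lin_span S).

Definition bounded_op A : Prop :=
  linear A /\ exists M : K, forall v, `|A v| <= M * `|v|.

Definition unital_subalgebra (F : set (V -> V)) : Prop :=
  [/\ F `<=` bounded_op, F idfun,
      forall (a : K) A B, F A -> F B -> F (a *: A + B) &
      forall A B, F A -> F B -> F (A \o B)].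

Definition two_sided_ideal (F J : set (V -> V)) : Prop :=
  [/\ J `<=` F, J 0,
      forall (a : K) A B, J A -> J B -> J (a *: A + B) &
      forall A B, F A -> J B -> J (A \o B) /\ J (B \o A)].

End operators.

Section wstar.
Context {R : realType} {I : choiceType}.
Local Notation H := (ell2 R I).

Definition sq_summable (x : nat -> H) : Prop :=
  (\esum_(k in [set: nat]) ((l2norm (x k)) ^+ 2)%:E < +oo)%E.

(* The w*-topology of B(H) is the one induced by its predual, the trace class
   operators, i.e. by the functionals A |-> tr (A T); these are exactly the
   A |-> sum_k <A x_k, y_k> with (x_k), (y_k) square summable. *)
Definition trace_pairing (x y : nat -> H) (A : H -> H) : R[i] :=
  sum (fun k => inner (A (x k)) (y k)).

Definition wstar_closure (S : set (H -> H)) : set (H -> H) :=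
  [set A | bounded_op A /\
    forall m (x y : 'I_m -> nat -> H) (e : R), 0 < e ->
      (forall j, sq_summable (x j) /\ sq_summable (y j)) ->
      exists2 B, S B & forall j, normc (trace_pairing (x j) (y j) (A - B)) < e].

Definition wstar_closed (S : set (H -> H)) : Prop := wstar_closure S `<=` S.

Definition orth_compl (S : set H) : set H :=
  [set f | forall g, S g -> inner f g = 0].

End wstar.

Section rkhs.
Context {R : realType} {X : Type}.
Implicit Types (H : set (X -> R[i])) (ip : (X -> R[i]) -> (X -> R[i]) -> R[i]).

Definition is_inner_product H ip : Prop :=
  [/\ forall (a : R[i]) f g h, H f -> H g -> H h ->
        ip (a *: f + g) h = a * ip f h + ip g h,
      forall f g, H f -> H g -> ip g f = (ip f g)^*,
      forall f, H f -> 0 <= ip f f &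
      forall f, H f -> ip f f = 0 -> f = 0].

Definition ip_complete H ip : Prop :=
  forall u : nat -> X -> R[i], (forall m, H (u m)) ->
    (forall e : R, 0 < e -> exists N, forall m p, (N <= m)%N -> (N <= p)%N ->
       ip (u m - u p) (u m - u p) < (e ^+ 2)%:C) ->
    exists2 f, H f & forall e : R, 0 < e -> exists N, forall m, (N <= m)%N ->
       ip (u m - f) (u m - f) < (e ^+ 2)%:C.

Definition is_RKHS H ip (K : X -> X -> R[i]) : Prop :=
  [/\ H 0 /\ (forall (a : R[i]) f g, H f -> H g -> H (a *: f + g)),
      is_inner_product H ip, ip_complete H ip,
      forall x, H (K^~ x) &
      forall f x, H f -> f x = ip f (K^~ x)].

End rkhs.

Section weights.
Context {R : realType} {n : nat}.

(* bprod mu [:: i1; ..; ik] = mu [:: i1; ..; ik] * mu [:: i2; ..; ik] * .. *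
   mu [:: ik], the weight written mu(alpha, g_0). *)
Fixpoint bprod (mu : seq 'I_n -> R) (a : seq 'I_n) : R :=
  if a is _ :: b then mu a * bprod mu b else 1.

End weights.

(* The value at the empty word is irrelevant. *)
Record weights (R : realType) (n : nat) := Weights {
  weight :> seq 'I_n -> R;
  weight_gt0 : forall b, b != [::] -> 0 < weight b;
  weight_left_bounded : forall i, has_ubound (range (fun a => weight (i :: a)));
  weight_right_bounded : forall i,
    has_ubound (range (fun a => bprod weight (rcons a i) / bprod weight a)) }.

Notation fock R n := (ell2 R (seq 'I_n)).

Section multishift.
Context {R : realType} {n : nat} (mu : weights R n).
Local Notation C := R[i].
Implicit Types (a b : seq 'I_n) (i : 'I_n) (lam : 'rV[C]_n).

Lemma bprod_gt0 a : 0 < bprod mu a.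
Proof. by elim: a => //= i a IH; rewrite mulr_gt0 ?weight_gt0. Qed.

Definition shift_coef i (f : fock R n) (b : seq 'I_n) : C :=
  if b is j :: a then (if j == i then (mu b)%:C * f a else 0) else 0.

Fact shift_ell2 i f : shift_coef i f \in @ell2_pred R (seq 'I_n).
Proof.
apply/ell2P; rewrite /sqnorm (esumID (range (cons i))) => [|b _]; last first.
  by rewrite lee_fin sqr_ge0.
rewrite [X in (_ + X)%E]esum1 ?adde0 ?setTI; last first.
  case=> [|j a] ja; first by rewrite /shift_coef normc0 expr0n.
  rewrite {1}/shift_coef.
  case: eqVneq => [ji|_]; last by rewrite normc0 expr0n.
  by exfalso; apply: ja; exists a; rewrite ?ji.
rewrite (@reindex_esum _ _ _ setT _ (cons i)); last first.
  by split => [a _|a b _ _ []|_ [a _ <-]]//; exists a.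
have [M MP] := weight_left_bounded mu i.
have M0 : 0 <= M.
  by apply: le_trans (ltW (weight_gt0 mu (_ : [:: i] != [::]))) (MP _ _) => //; exists [::].
apply: le_lt_trans (@sqnorm_bound _ _ M (fun a => shift_coef i f (i :: a)) f M0 _) _.
  move=> a; rewrite /= eqxx normcM ler_wpM2r ?normc_ge0//.
  have w0 := ltW (weight_gt0 mu (isT : i :: a != [::])).
  by rewrite /= expr0n addr0 sqrtr_sqr ger0_norm//; apply: MP; exists a.
by rewrite lte_mul_pinfty ?lee_fin ?sqr_ge0//; apply/ell2P/(valP f).
Qed.

Definition shift i (f : fock R n) : fock R n := Ell2 (shift_ell2 i f).

Lemma shiftE i f b : shift i f b = shift_coef i f b. Proof. by []. Qed.

Lemma shift_basis i a : shift i (basis a) = (mu (i :: a))%:C *: basis (i :: a).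
Proof.
apply: ell2E => b; rewrite ell2ZE shiftE !basisE.
case: b => [|j b].
  by rewrite (_ : ([::] == i :: a) = false) ?mulr0n ?mulr0.
rewrite /shift_coef basisE eqseq_cons.
case: eqVneq => [->|_]; last by rewrite mulr0n mulr0.
rewrite andTb.
by case: eqVneq => [->|_]; rewrite ?mulr1n ?mulr0n ?mulr1 ?mulr0.
Qed.

Lemma shift_linear i : linear (shift i).
Proof.
move=> k f g; apply: ell2E => b; rewrite ell2DE ell2ZE !shiftE.
case: b => [|j b]; first by rewrite mulr0 addr0.
rewrite /shift_coef; case: eqP => _; last by rewrite mulr0 addr0.
by rewrite ell2DE ell2ZE mulrDr mulrCA.
Qed.

Definition hardy : set (fock R n -> fock R n) :=
  smallest [set F | unital_subalgebra F /\ wstar_closed F] (range shift).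

Definition commutators : set (fock R n -> fock R n) :=
  [set A | exists i j, A = (shift i \o shift j) - (shift j \o shift i)].

Definition commutator_ideal : set (fock R n -> fock R n) :=
  smallest [set J | two_sided_ideal hardy J /\ wstar_closed J] commutators.

Definition vacuum : fock R n := basis [::].

Definition ideal_at_vacuum : set (fock R n) := [set A vacuum | A in commutator_ideal].

Definition word_eval lam a : C := \prod_(i <- a) lam 0 i.

Definition conv_domain_esum lam : \bar R :=
  (\esum_(a in [set: seq 'I_n]) (normc (word_eval lam a) ^+ 2 / bprod mu a ^+ 2)%:E)%E.

Definition conv_domain : set 'rV[C]_n := [set lam | (conv_domain_esum lam < +oo)%E].

Definition zvec_coef lam a : C := (word_eval lam a)^* / (bprod mu a)%:C.

Fact zvec_ell2 (lam : conv_domain) : zvec_coef (val lam) \in @ell2_pred R (seq 'I_n).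
Proof.
apply/ell2P; case: lam => lam /= /set_mem; apply: le_lt_trans.
apply: le_esum => a _; rewrite lee_fin /zvec_coef normcM normcV exprMn exprVn.
have -> : normc (word_eval lam a)^* = normc (word_eval lam a).
  by case: (word_eval lam a) => x y /=; rewrite sqrrN.
by rewrite /= expr0n addr0 sqrtr_sqr ger0_norm// ltW// bprod_gt0.
Qed.

Definition zvec (lam : conv_domain) : fock R n := Ell2 (zvec_ell2 lam).

Definition monomial lam (k : {ffun 'I_n -> nat}) : C := \prod_i lam 0 i ^+ k i.

Definition Lambda (k : {ffun 'I_n -> nat}) : set (seq 'I_n) :=
  [set a | forall lam, word_eval lam a = monomial lam k].

(* The sums over Lambda k below are thus genuine finite sums. *)
Lemma finite_Lambda k : finite_set (Lambda k).
Proof.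
apply: (@sub_finite_set _ _ (range (@tval (\sum_i k i) 'I_n))); last first.
  exact: finite_image.
move=> a /(_ (const_mx 2)); rewrite /word_eval /monomial.
under eq_bigr do rewrite mxE; under [in RHS]eq_bigr do rewrite mxE.
rewrite big_const_seq count_predT iter_mulr_1 prodrXr.
have p2 : 0 < 2 :> C by rewrite ltr0n.
have n2 : (2 : C) != 1 by rewrite pnatr_eq1.
move=> /(ieexprIn p2 n2) /eqP sz.
by exists (Tuple sz).
Qed.

Definition omega k : R := \sum_(a \in Lambda k) (bprod mu a ^+ 2)^-1.

Definition yvec k : fock R n :=
  (omega k)^-1%:C *: \sum_(a \in Lambda k) (bprod mu a)^-1%:C *: basis a.

Definition sym_fock : set (fock R n) := closed_span (range yvec).

Definition funrep (f : fock R n) : conv_domain -> C :=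
  fun lam : conv_domain => inner f (zvec lam).

Definition coef_sqnorm (c : {ffun 'I_n -> nat} -> C) : \bar R :=
  (\esum_(k in [set: {ffun 'I_n -> nat}]) (normc (c k) ^+ 2 / omega k)%:E)%E.

(* [partial_sum x @ totally --> s] is unconditional summation: the net of sums
   over finite sets of indices converges. *)
Definition power_series_rep (phi : conv_domain -> C) (c : {ffun 'I_n -> nat} -> C) : Prop :=
  (forall lam : conv_domain,
     partial_sum (fun k => c k * monomial (val lam) k) @ totally --> phi lam) /\
  (coef_sqnorm c < +oo)%E.

Definition H2 : set (conv_domain -> C) := [set phi | exists c, power_series_rep phi c].

(* The coefficients are unique as soon as the domain is a neighborhood of 0. *)
Definition H2_coef (phi : conv_domain -> C) : {ffun 'I_n -> nat} -> C :=
  xget (fun=> 0) [set c | power_series_rep phi c].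

Definition H2_norm (phi : conv_domain -> C) : R :=
  Num.sqrt (fine (coef_sqnorm (H2_coef phi))).

Definition H2_inner (phi psi : conv_domain -> C) : C :=
  sum (fun k => H2_coef phi k * (H2_coef psi k)^* / (omega k)%:C).

Definition fock_kernel (zeta lam : conv_domain) : C := inner (zvec lam) (zvec zeta).

End multishift.

Arguments conv_domain {R n} mu.
Arguments sym_fock {R n} mu.
Arguments commutator_ideal {R n} mu.
Arguments zvec {R n} mu lam.
Arguments yvec {R n} mu k.
Arguments funrep {R n} mu f lam.
Arguments power_series_rep {R n} mu phi c.
Arguments H2 {R n} mu.
Arguments H2_norm {R n} mu phi.
Arguments H2_inner {R n} mu phi psi.
Arguments fock_kernel {R n} mu zeta lam.

(* Main.v *)
(** All four spaces coincide with the space of vectors f for which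
    mu(alpha, g_0) f(alpha) depends only on the multiset of letters of alpha,
    because of the cycle of inclusions
    F_s^2 <= span z_lambda <= (J_c 1)^perp <= {such f} <= F_s^2.
    (1) Averaging z at the points of a torus whose coordinates are multiples of
    roots of unity isolates each y^(k) in the limit.
    (2) z_lambda is a joint eigenvector of the W_i^*, hence
    <A f, z_lambda> = c <f, z_lambda> for A in the Hardy algebra, so that the
    operators A with <A f, z_lambda> = 0 for all f form a w*-closed ideal which
    contains the commutators.
    (3) Orthogonality to W_alpha [W_i, W_j] W_beta 1 says that
    mu(alpha, g_0) f(alpha) is unchanged by adjacent transpositions of letters.
    (4) Such an f is the sum of its components along the y^(k).
    The z_lambda being total in F_s^2, f |-> <f, z_lambda> is injective on it,
    and (ii) and (iii) are transported through this map. *)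
Require Import Defs.
From mathcomp Require Import all_boot all_order all_algebra.
From mathcomp Require Import complex.
From mathcomp Require Import all_classical all_reals all_analysis.
From mathcomp.analysis.showcase Require Import summability.
From mathcomp Require Import finmap ring lra.

Import Order.TTheory GRing.Theory Num.Theory.
Import numFieldNormedType.Exports.
Import Normc.

Local Open Scope classical_set_scope.
Local Open Scope complex_scope.
Local Open Scope ring_scope.

Set Implicit Arguments.
Unset Strict Implicit.

#[local] Existing Instance totally_filter.

(** * Sums over arbitrary index sets as limits of the net of finite partial sums *)

Section summation.
Context {R : realType} {I : choiceType}.
Implicit Types (X Y : {fset I}) (a : I -> R) (x y : I -> R[i]).

Lemma partial_sumE {V : zmodType} (x : I -> V) X : partial_sum x X = \sum_(i <- X) x i.
Proof. by rewrite /partial_sum big_seq_fsetE. Qed.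

Lemma totally_ge X : totally [set Y | fsubset X Y].
Proof. by exists X. Qed.

Lemma esum_fsetP a (M : \bar R) : (forall i, 0 <= a i) ->
  (\esum_(i in [set: I]) (a i)%:E <= M)%E <->
  forall X, ((\sum_(i <- X) a i)%:E <= M)%E.
Proof.
move=> a0; split=> [aM X|aM].
  apply: le_trans aM; apply: ereal_sup_ubound; exists [set` X] => //.
  by rewrite fsbig_finite ?set_fsetK ?sumEFin//.
apply: ge_ereal_sup => _ [X [Xf _] <-].
by rewrite fsbig_finite// sumEFin.
Qed.

Lemma ler_sum_fset_sub a X Y : (forall i, 0 <= a i) -> fsubset X Y ->
  \sum_(i <- X) a i <= \sum_(i <- Y) a i.
Proof.
move=> a0 XY; rewrite (big_fsetID _ (mem X) Y) /= -[leLHS]addr0 lerD ?sumr_ge0//.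
rewrite le_eqVlt; apply/orP; left; apply/eqP; congr bigop.
congr enum_fset; apply/fsetP => i; rewrite !inE.
by apply/idP/andP => [iX|[]//]; rewrite iX (fsubsetP XY).
Qed.

(** A finite set whose partial sum comes within [e] of the supremum leaves less than [e] to every
    finite set disjoint from it. All later limit arguments over finite sets rest on this. *)
Lemma esum_tail a (e : R) : (forall i, 0 <= a i) ->
  (\esum_(i in [set: I]) (a i)%:E < +oo)%E -> 0 < e ->
  exists X0, forall X, {in X, forall i, i \notin X0} -> \sum_(i <- X) a i < e.
Proof.
move=> a0 afin e0; set s := esum _ _ in afin.
have sf : s \is a fin_num by rewrite ge0_fin_numE ?esum_ge0// => i _; rewrite lee_fin.
have : (s - e%:E < s)%E by rewrite lteBlDr// lteDl// lte_fin.
move=> /ereal_sup_gt[_ [Z [Zf _] <-]]; rewrite fsbig_finite// sumEFin => se.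
exists (fset_set Z) => X XZ; set Y := fset_set Z in se XZ *.
have /(_ (X `|` Y)%fset) := (esum_fsetP _ a0).1 (lexx s).
rewrite (big_fsetID _ (mem Y)) /=.
have -> : [fset x in (X `|` Y)%fset | mem Y x]%fset = Y.
  by apply/fsetP => i; rewrite !inE/=; case: (i \in Y); rewrite ?andbF ?orbT.
have -> : [fset x in (X `|` Y)%fset | ~~ mem Y x]%fset = X.
  apply/fsetP => i; rewrite !inE/=; case iX : (i \in X) => /=; first by rewrite XZ.
  by case: (i \in Y).
move: se; rewrite lteBlDr//; case: s sf {afin} => //= r _.
by rewrite -EFinD lte_fin lee_fin => h1 h2; lra.
Qed.

(** Cauchy criterion: beyond the set [X0] of [esum_tail], two partial sums of [b] differ by a tail
    that [a] dominates. *)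
Lemma partial_sum_cvgR (a b : I -> R) : (forall i, `|b i| <= a i) ->
  (\esum_(i in [set: I]) (a i)%:E < +oo)%E ->
  cvg (partial_sum b @ totally).
Proof.
move=> ba afin.
have a0 i : 0 <= a i by apply: le_trans (ba i).
apply/cauchy_cvgP/cauchy_exP => e e0.
have [X0 X0P] := esum_tail a0 afin e0.
exists (partial_sum b X0); apply: filterS (totally_ge X0) => X /= XX.
rewrite /ball/= !partial_sumE (big_fsetID _ (mem X0) X) /=.
have -> : [fset x in X | mem X0 x]%fset = X0.
  apply/fsetP => i; rewrite !inE/=; case iX : (i \in X0); rewrite ?andbT ?andbF//.
  by rewrite (fsubsetP XX).
rewrite opprD addrA subrr add0r normrN.
apply: le_lt_trans (ler_norm_sum _ _ _) _.
apply: le_lt_trans (ler_sum _ (fun i _ => ba i)) _.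
by apply: X0P => i; rewrite !inE => /andP[].
Qed.

End summation.

(** * Limits in the complex plane through the real modulus *)

Section complex_limits.
Context {R : realType}.
Implicit Types z w : R[i].

(** The order of [R[i]] compares only numbers with equal imaginary parts, so a positive radius is a
    real number and real radii suffice. *)
Lemma cvgP_normc {T} {F : set_system T} {FF : Filter F} (f : T -> R[i]) z :
  (f @ F --> z) <-> (forall e : R, 0 < e -> \forall t \near F, normc (z - f t) < e).
Proof.
split=> [/cvgrPdist_lt h e e0|h].
  have /h : (0 : R[i]) < e%:C by rewrite ltcR.
  by apply: filterS => t; rewrite -ltcR.
apply/cvgrPdist_lt => -[e e'] e0.
have e'0 : e' = 0 by move: e0; rewrite ltcE /= => /andP[/eqP].
move: e0; rewrite e'0 ltcR => /h.
by apply: filterS => t; rewrite -ltcR.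
Qed.

Lemma normc_Re z : `|complex.Re z| <= normc z.
Proof.
by case: z => a b /=; rewrite -sqrtr_sqr ler_wsqrtr// lerDl sqr_ge0.
Qed.

Lemma normc_Im z : `|complex.Im z| <= normc z.
Proof.
by case: z => a b /=; rewrite -sqrtr_sqr ler_wsqrtr// lerDr sqr_ge0.
Qed.

Lemma normc_le_ReIm z : normc z <= `|complex.Re z| + `|complex.Im z|.
Proof.
case: z => a b /=.
rewrite -(@ler_pXn2r _ 2) ?nnegrE ?addr_ge0 ?sqrtr_ge0// sqr_sqrtr ?addr_ge0 ?sqr_ge0//.
rewrite sqrrD !real_normK ?num_real// -addrA lerD2l lerDr mulrn_wge0// mulr_ge0//.
Qed.

Lemma cvg_ReIm {T} {F : set_system T} {FF : ProperFilter F} (f : T -> R[i]) :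
  cvg (complex.Re (f t) @[t --> F]) -> cvg (complex.Im (f t) @[t --> F]) -> cvg (f @ F).
Proof.
move=> /cvg_ex[a /cvgrPdist_lt fa] /cvg_ex[b /cvgrPdist_lt fb].
apply/cvg_ex; exists (a +i* b); apply/cvgP_normc => e e0.
have e20 : 0 < e / 2 by rewrite divr_gt0.
near=> t.
apply: le_lt_trans (normc_le_ReIm _) _; rewrite [ltRHS](splitr e) ltrD//.
  have : `|a - complex.Re (f t)| < e / 2 by near: t; exact: fa.
  by rewrite /=; case: (f t).
have : `|b - complex.Im (f t)| < e / 2 by near: t; exact: fb.
by rewrite /=; case: (f t).
Unshelve. all: by end_near. Qed.

Lemma partial_sum_cvgC {I : choiceType} (x : I -> R[i]) :
  (\esum_(i in [set: I]) (normc (x i))%:E < +oo)%E ->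
  cvg (partial_sum x @ totally).
Proof.
move=> xfin; apply: cvg_ReIm.
  rewrite (_ : (fun t => _) = partial_sum (fun i => complex.Re (x i))).
    by apply: partial_sum_cvgR xfin => i; apply: normc_Re.
  by apply/funext => X; rewrite /= !partial_sumE raddf_sum.
rewrite (_ : (fun t => _) = partial_sum (fun i => complex.Im (x i))).
  by apply: partial_sum_cvgR xfin => i; apply: normc_Im.
by apply/funext => X; rewrite /= !partial_sumE raddf_sum.
Qed.

End complex_limits.

(** * The inner product of square summable families *)

Section hilbert.
Context {R : realType} {I : choiceType}.
Local Notation H := (ell2 R I).
Implicit Types (u v w : H) (X : {fset I}).

Lemma normcJ (z : R[i]) : normc z^* = normc z.
Proof. by case: z => a b /=; rewrite sqrrN. Qed.

Lemma normcC (r : R) : 0 <= r -> normc r%:C = r.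
Proof. by move=> r0; rewrite /= expr0n addr0 sqrtr_sqr ger0_norm. Qed.

Lemma realC_conj (r : R) : (r%:C)^* = r%:C :> R[i].
Proof. by apply/conj_Creal; rewrite complex_real. Qed.

Lemma sqnorm_leP (f : I -> R[i]) (M : R) :
  (sqnorm f <= M%:E)%E <-> forall X, \sum_(i <- X) normc (f i) ^+ 2 <= M.
Proof. by rewrite esum_fsetP// => i; exact: sqr_ge0. Qed.

Lemma sum_fset_l2norm u X : \sum_(i <- X) normc (u i) ^+ 2 <= l2norm u ^+ 2.
Proof. by move: X; apply/sqnorm_leP; rewrite l2norm_sq. Qed.

Lemma l2norm_leP u (e : R) : 0 <= e ->
  l2norm u <= e <-> forall X, \sum_(i <- X) normc (u i) ^+ 2 <= e ^+ 2.
Proof.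
move=> e0; rewrite -sqnorm_leP -l2norm_sq lee_fin ler_pXn2r ?nnegrE ?l2norm_ge0//.
Qed.

Lemma normc_coord u i : normc (u i) <= l2norm u.
Proof.
rewrite -(@ler_pXn2r _ 2) ?nnegrE ?normc_ge0 ?l2norm_ge0//.
have := sum_fset_l2norm u [fset i]%fset.
by rewrite big_seq_fset1.
Qed.

(** Termwise 2xy <= x^2 + y^2. This crude bound already gives absolute convergence of the series of
    [inner]; Cauchy-Schwarz is derived from it later by scaling. *)
Lemma sum_normc_inner u v X :
  \sum_(i <- X) normc (u i * (v i)^*) <= (l2norm u ^+ 2 + l2norm v ^+ 2) / 2.
Proof.
apply: (@le_trans _ _ (\sum_(i <- X) (normc (u i) ^+ 2 + normc (v i) ^+ 2) / 2)).
  apply: ler_sum => i _; rewrite normcM normcJ.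
  by have := sqr_ge0 (normc (u i) - normc (v i)); nra.
by rewrite -mulr_suml big_split ler_wpM2r// lerD// sum_fset_l2norm.
Qed.

(** [inner] is defined as a limit, hence carries information only once the net converges; every
    algebraic property of it goes through this lemma and [inner_unique]. *)
Lemma inner_cvg u v :
  partial_sum (fun i => u i * (v i)^*) @ totally --> inner u v.
Proof.
apply: partial_sum_cvgC.
apply: (@le_lt_trans _ _ ((l2norm u ^+ 2 + l2norm v ^+ 2) / 2)%:E); last exact: ltry.
apply/esum_fsetP => [i|X]; first exact: normc_ge0.
by rewrite lee_fin sum_normc_inner.
Qed.

Lemma inner_unique u v (z : R[i]) :
  partial_sum (fun i => u i * (v i)^*) @ totally --> z -> inner u v = z.
Proof. by move=> /cvg_lim; apply; exact: norm_hausdorff. Qed.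

Lemma inner_linear (a : R[i]) u v w : inner (a *: u + v) w = a * inner u w + inner v w.
Proof.
apply: inner_unique.
rewrite (_ : partial_sum _ = a \*: partial_sum (fun i => u i * (w i)^*)
    \+ partial_sum (fun i => v i * (w i)^*)); last first.
  apply/funext => X; rewrite /= !partial_sumE.
  rewrite scaler_sumr -big_split/=; apply: eq_bigr => i _.
  by rewrite mulrDl -mulrA.
exact: (cvgD (cvgZl_tmp (k := a) (@inner_cvg u w)) (@inner_cvg v w)).
Qed.

Lemma innerC u v : inner v u = (inner u v)^*.
Proof.
apply: inner_unique; apply/cvgP_normc => e /((cvgP_normc _ _).1 (@inner_cvg u v)).
apply: filterS => X; congr (_ < e).
rewrite -[LHS]normcJ rmorphB/= !partial_sumE rmorph_sum/=; congr (normc (_ - _)).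
by apply: eq_bigr => i _; rewrite rmorphM/= conjCK mulrC.
Qed.

Lemma inner0l v : inner 0 v = 0.
Proof. by have := inner_linear (-1) 0 0 v; rewrite scaler0 addr0 mulN1r addNr. Qed.

Lemma innerZl (a : R[i]) u v : inner (a *: u) v = a * inner u v.
Proof. by rewrite -[a *: u]addr0 inner_linear inner0l addr0. Qed.

Lemma innerDl u v w : inner (u + v) w = inner u w + inner v w.
Proof. by rewrite -[u]scale1r inner_linear mul1r scale1r. Qed.

Lemma innerBl u v w : inner (u - v) w = inner u w - inner v w.
Proof. by rewrite innerDl -scaleN1r innerZl mulN1r. Qed.

Lemma inner_suml {J : Type} (r : seq J) (P : pred J) (F : J -> H) w :
  inner (\sum_(j <- r | P j) F j) w = \sum_(j <- r | P j) inner (F j) w.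
Proof. by apply: (big_morph (inner^~ w)) => [u v|]; rewrite ?innerDl ?inner0l. Qed.

Lemma innerZr (a : R[i]) u v : inner u (a *: v) = a^* * inner u v.
Proof. by rewrite innerC innerZl rmorphM/= -innerC. Qed.

Lemma innerBr u v w : inner w (u - v) = inner w u - inner w v.
Proof. by rewrite innerC innerBl rmorphB/= -!innerC. Qed.

(** Reconciles the two definitions: [inner] is a limit of finite sums, [l2norm] comes from a
    supremum of the same sums, and beyond [X0] at most [e / 2] is missing. *)
Lemma inner_l2norm u : inner u u = (l2norm u ^+ 2)%:C.
Proof.
apply: inner_unique; apply/cvgP_normc => e e0.
have ufin : (\esum_(i in [set: I]) (normc (u i) ^+ 2)%:E < +oo)%E.
  by rewrite -/(sqnorm u) -l2norm_sq ltry.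
have [X0 X0P] := esum_tail (fun i => sqr_ge0 (normc (u i))) ufin (divr_gt0 e0 (ltr0n _ 2)).
apply: filterS (totally_ge X0) => X /= X0X.
have uE : partial_sum (fun i => u i * (u i)^*) X = (\sum_(i <- X) normc (u i) ^+ 2)%:C.
  rewrite partial_sumE rmorph_sum/=; apply: eq_bigr => i _.
  by rewrite -normCK rmorphXn.
have uX := sum_fset_l2norm u X.
rewrite uE -rmorphB normcC ?subr_ge0//.
have : l2norm u ^+ 2 <= \sum_(i <- X) normc (u i) ^+ 2 + e / 2; last by move=> ?; lra.
rewrite -lee_fin l2norm_sq; apply/sqnorm_leP => Y.
rewrite (big_fsetID _ (mem X) Y) /= lerD//.
  apply: ler_sum_fset_sub => [i|]; first exact: sqr_ge0.
  by apply/fsubsetP => i; rewrite !inE/= => /andP[].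
apply/ltW/X0P => i; rewrite !inE/= => /andP[_]; apply: contra.
exact: (fsubsetP X0X).
Qed.

End hilbert.

(** * Cauchy-Schwarz, closed spans, orthogonal complements and completeness *)

Section hilbert_topology.
Context {R : realType} {I : choiceType}.
Local Notation H := (ell2 R I).
Implicit Types (u v w : H) (X : {fset I}) (S V : set H).

Lemma ler_normcD (z w : R[i]) : normc (z + w) <= normc z + normc w.
Proof. exact: (le_normcD (z : Rcomplex R) w). Qed.

Lemma normcN (z : R[i]) : normc (- z) = normc z.
Proof. by case: z => a b /=; rewrite !sqrrN. Qed.

Lemma ler_normc_sum {J : Type} (r : seq J) (F : J -> R[i]) :
  normc (\sum_(j <- r) F j) <= \sum_(j <- r) normc (F j).
Proof.
elim: r => [|j r IH]; first by rewrite !big_nil normc0.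
by rewrite !big_cons (le_trans (ler_normcD _ _))// lerD2l.
Qed.

Lemma normc_inner_le u v : normc (inner u v) <= l2norm u * l2norm v.
Proof.
have amgm u' v' : normc (inner u' v') <= (l2norm u' ^+ 2 + l2norm v' ^+ 2) / 2.
  apply/ler_addgt0Pr => e e0.
  have [X uvX] := filter_ex ((cvgP_normc _ _).1 (@inner_cvg _ _ u' v') _ e0).
  rewrite -[inner u' v'](subrK (partial_sum (fun i => u' i * (v' i)^*) X)) addrC.
  apply: le_trans (ler_normcD _ _) _; apply: lerD (ltW uvX).
  by rewrite partial_sumE; apply: le_trans (ler_normc_sum _ _) (sum_normc_inner _ _ _).
have [/l2norm_eq0 ->|u0] := eqVneq (l2norm u) 0.
  by rewrite inner0l normc0 mulr_ge0 ?l2norm_ge0.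
have [/l2norm_eq0 ->|v0] := eqVneq (l2norm v) 0.
  by rewrite innerC inner0l normcJ normc0 mulr_ge0 ?l2norm_ge0.
have up : 0 < l2norm u by rewrite lt_def u0 l2norm_ge0.
have vp : 0 < l2norm v by rewrite lt_def v0 l2norm_ge0.
(* Scaled to unit vectors, the bound by half the sum of squares becomes 1; homogeneity gives
   Cauchy-Schwarz. *)
have := amgm ((l2norm u)^-1%:C *: u) ((l2norm v)^-1%:C *: v).
rewrite innerZl innerZr realC_conj !normcM !l2normZ !normcC ?invr_ge0 ?l2norm_ge0//.
rewrite !mulVf// expr1n divff// ler_pdivrMl// ler_pdivrMl// mulr1.
by rewrite mulrC.
Qed.

Lemma cvgP_l2norm {T} {F : set_system T} {FF : Filter F} (f : T -> H) u :
  (f @ F --> u) <-> (forall e : R, 0 < e -> \forall t \near F, l2norm (u - f t) < e).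
Proof.
split=> [/cvgrPdist_lt h e e0|h].
  have /h : (0 : R[i]) < e%:C by rewrite ltcR.
  by apply: filterS => t; rewrite -ltcR.
apply/cvgrPdist_lt => -[e e'] e0.
have e'0 : e' = 0 by move: e0; rewrite ltcE /= => /andP[/eqP].
move: e0; rewrite e'0 ltcR => /h.
by apply: filterS => t; rewrite -ltcR.
Qed.

Lemma closureP_l2norm S u :
  closure S u <-> forall e : R, 0 < e -> exists2 v, S v & l2norm (u - v) < e.
Proof.
split=> [h e e0|h B].
  have : nbhs u [set v | `|u - v| < e%:C].
    by rewrite -filter_from_norm_nbhs; exists e%:C => //=; rewrite ltcR.
  by move=> /h[v [Sv]]; rewrite /= ltcR => uv; exists v.
rewrite -filter_from_norm_nbhs => -[[e e'] /= e0 eB].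
have e'0 : e' = 0 by move: e0; rewrite ltcE /= => /andP[/eqP].
move: e0 eB; rewrite e'0 ltcR => /h[v Sv uv] eB.
by exists v; split=> //; apply: eB; rewrite /ball_/= ltcR.
Qed.

Lemma inner_cvgl {T} {F : set_system T} {FF : Filter F} (f : T -> H) u v :
  f @ F --> u -> inner (f t) v @[t --> F] --> inner u v.
Proof.
move=> /cvgP_l2norm fu; apply/cvgP_normc => e e0.
have v1 : 0 < l2norm v + 1 by rewrite ltr_wpDl ?l2norm_ge0.
have := fu _ (divr_gt0 e0 v1); apply: filterS => t; rewrite ltr_pdivlMr// => ft.
rewrite -innerBl; apply: le_lt_trans (normc_inner_le _ _) _; apply: le_lt_trans ft.
by rewrite ler_wpM2l ?l2norm_ge0// lerDl.
Qed.

Definition submodule V := V 0 /\ forall (a : R[i]) u v, V u -> V v -> V (a *: u + v).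

Lemma submodule_sum V {J : Type} (r : seq J) (c : J -> R[i]) (x : J -> H) :
  submodule V -> (forall j, V (x j)) -> V (\sum_(j <- r) c j *: x j).
Proof.
move=> [V0 Vl] Vx; elim: r => [|j r IH]; first by rewrite big_nil.
by rewrite big_cons; apply: Vl.
Qed.

Lemma submoduleZ V (a : R[i]) u : submodule V -> V u -> V (a *: u).
Proof. by move=> [V0 Vl] Vu; rewrite -[_ *: _]addr0; apply: Vl. Qed.

Lemma submoduleB V u v : submodule V -> V u -> V v -> V (u - v).
Proof. by move=> [V0 Vl] Vu Vv; rewrite addrC -scaleN1r; apply: Vl. Qed.

Lemma submodule_closure V : submodule V -> submodule (closure V).
Proof.
move=> [V0 Vl]; split=> [|a u v]; first exact: subset_closure.
move=> /closureP_l2norm uV /closureP_l2norm vV; apply/closureP_l2norm => e e0.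
have a1 : 0 < normc a + 1 by rewrite ltr_wpDl ?normc_ge0.
have [u' Vu' uu'] := uV _ (divr_gt0 (divr_gt0 e0 (ltr0n _ 2)) a1).
have [v' Vv' vv'] := vV _ (divr_gt0 e0 (ltr0n _ 2)).
exists (a *: u' + v'); first exact: Vl.
rewrite opprD addrACA -scalerBr; apply: le_lt_trans (l2normD _ _) _.
rewrite l2normZ [ltRHS](splitr e) ler_ltD//.
move: uu'; rewrite ltr_pdivlMr// mulrC => /ltW; apply: le_trans.
by rewrite ler_wpM2r ?l2norm_ge0// lerDl.
Qed.

Lemma sub_lin_span S : S `<=` lin_span S.
Proof.
move=> u Su; exists 1, (fun=> 1), (fun=> u); split=> //.
by rewrite big_ord1 scale1r.
Qed.

Lemma submodule_lin_span S : submodule (lin_span S).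
Proof.
split; first by exists 0, (fun=> 0), (fun=> 0); split=> [[]//|]; rewrite big_ord0.
move=> a _ _ [m [c [u [Su ->]]]] [p [d [v [Sv ->]]]].
exists (m + p)%N, (fun i => match fintype.split i with inl j => a * c j | inr j => d j end),
  (fun i => match fintype.split i with inl j => u j | inr j => v j end).
split=> [i|]; first by case: (fintype.split i).
rewrite big_split_ord/= scaler_sumr; congr (_ + _); apply: eq_bigr => i _.
  by rewrite (unsplitK (inl i)) scalerA.
by rewrite (unsplitK (inr i)).
Qed.

Lemma submodule_closed_span S : submodule (closed_span S).
Proof. exact/submodule_closure/submodule_lin_span. Qed.

(** The way to prove inclusions of closed spans: only the generators remain to be checked. *)
Lemma closed_span_min S V : submodule V -> closure V `<=` V -> S `<=` V ->
  closed_span S `<=` V.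
Proof.
move=> Vs Vc SV; apply: subset_trans Vc; apply: closureS => _ [m [c [u [Su ->]]]].
by apply: submodule_sum => // i; apply/SV/Su.
Qed.

Lemma closed_span_sub S V : S `<=` closed_span V -> closed_span S `<=` closed_span V.
Proof.
move=> SV; apply: closed_span_min => //; first exact: submodule_closed_span.
by rewrite -(closure_id _).1//; exact: closed_closure.
Qed.

Lemma submodule_orth_compl S : submodule (orth_compl S).
Proof.
split=> [g _|a u v Su Sv g Sg]; first by rewrite inner0l.
by rewrite inner_linear Su// Sv// mulr0 addr0.
Qed.

Lemma closure_orth_compl S : closure (orth_compl S) `<=` orth_compl S.
Proof.
move=> u /closureP_l2norm uS g Sg; apply: eq0_normc; apply/eqP; rewrite eq_le normc_ge0 andbT.
apply/ler_addgt0Pr => e e0; rewrite add0r.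
have g1 : 0 < l2norm g + 1 by rewrite ltr_wpDl ?l2norm_ge0.
have [v Sv uv] := uS _ (divr_gt0 e0 g1).
rewrite -[u](subrK v) innerDl (Sv g Sg) addr0.
apply: le_trans (normc_inner_le _ _) _; move: uv; rewrite ltr_pdivlMr// => /ltW; apply: le_trans.
by rewrite ler_wpM2l ?l2norm_ge0// lerDl.
Qed.

Lemma orth_complC S V : S `<=` orth_compl V -> V `<=` orth_compl S.
Proof. by move=> SV v Vv s Ss; rewrite innerC SV// conjC0. Qed.

(** The double complement of [S] is closed and contains [S], hence contains [closure S]. *)
Lemma orth_compl_closure S : orth_compl (closure S) = orth_compl S.
Proof.
apply/seteqP; split=> u uS g Sg; first exact/uS/subset_closure.
move: u uS g Sg; apply: orth_complC => g Sg.
apply: closure_orth_compl; move: g Sg; apply: closureS.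
exact: orth_complC.
Qed.

Lemma sqnorm_restr u (P : pred I) :
  (fun i => if P i then u i else 0) \in @ell2_pred R I.
Proof.
apply/ell2P; apply: le_lt_trans (@sqnorm_bound _ _ 1 _ u ler01 _) _ => [i|].
  by rewrite mul1r; case: (P i); rewrite ?normc0 ?normc_ge0.
by rewrite expr1n mul1e -l2norm_sq ltry.
Qed.

(** The orthogonal projection onto the coordinates in [P]. *)
Definition restr (P : pred I) u : H := Ell2 (sqnorm_restr u P).

Lemma restr_tail u (e : R) : 0 < e ->
  exists X0, forall P : pred I, {in X0, forall i, ~~ P i} -> l2norm (restr P u) < e.
Proof.
move=> e0; have e20 : 0 < e / 2 by rewrite divr_gt0.
have ufin : (\esum_(i in [set: I]) (normc (u i) ^+ 2)%:E < +oo)%E.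
  by rewrite -/(sqnorm u) -l2norm_sq ltry.
have [X0 X0P] := esum_tail (fun i => sqr_ge0 (normc (u i))) ufin (exprn_gt0 2 e20).
exists X0 => P PX0; apply: (@le_lt_trans _ _ (e / 2)); last by lra.
apply/l2norm_leP => [|X]; first exact: ltW.
rewrite (big_fsetID _ P X) /= [X in _ + X]big1_fset ?addr0 => [|i]; last first.
  by rewrite !inE/= => /andP[_ /negbTE ->]; rewrite normc0 expr0n.
rewrite (eq_big_seq (fun i => normc (u i) ^+ 2)) => [|i]; last first.
  by rewrite !inE/= => /andP[_ ->].
apply/ltW/X0P => i; rewrite !inE/= => /andP[_]; apply: contraTN; exact: PX0.
Qed.

Lemma cvg_normc {T} {F : set_system T} {FF : Filter F} (f : T -> R[i]) z :
  f @ F --> z -> normc (f t) @[t --> F] --> normc z.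
Proof.
move=> /cvgP_normc fz; apply/cvgrPdist_lt => e /fz; apply: filterS => t.
apply: le_lt_trans; rewrite ler_norml lerBlDr; apply/andP; split.
  rewrite lerNl opprB lerBlDr -[in leLHS](subrK z (f t)).
  by apply: le_trans (ler_normcD _ _) _; rewrite -opprB normcN.
by rewrite -{1}(subrK (f t) z) ler_normcD.
Qed.

Lemma ell2_complete (u : nat -> H) :
  (forall e : R, 0 < e -> exists N, forall m p, (N <= m)%N -> (N <= p)%N ->
     l2norm (u m - u p) < e) ->
  exists f, forall e : R, 0 < e -> exists N, forall m, (N <= m)%N -> l2norm (u m - f) < e.
Proof.
move=> uC.
have cvg_coord i : cvg (u m i @[m --> \oo]).
  apply: cvg_ReIm; apply/cauchy_cvgP/cauchy_exP => e /uC[N NP].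
    exists (complex.Re (u N i)); exists N => // m /= Nm.
    rewrite /ball/= -raddfB/=; apply: le_lt_trans (normc_Re _) _.
    exact: le_lt_trans (normc_coord (u N - u m) i) (NP _ _ _ _).
  exists (complex.Im (u N i)); exists N => // m /= Nm.
  rewrite /ball/= -raddfB/=; apply: le_lt_trans (normc_Im _) _.
  exact: le_lt_trans (normc_coord (u N - u m) i) (NP _ _ _ _).
pose g i := lim (u m i @[m --> \oo]).
(* A finite sum of squares is continuous in the coordinates, so the Cauchy estimate survives letting
   [p] tend to infinity. *)
have bound (e : R) N m : (forall p, (N <= p)%N -> l2norm (u m - u p) <= e) ->
    forall X, \sum_(i <- X) normc (u m i - g i) ^+ 2 <= e ^+ 2.
  move=> NP X.
  have : \sum_(i <- X) normc (u m i - u p i) ^+ 2 @[p --> \oo] -->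
         \sum_(i <- X) normc (u m i - g i) ^+ 2.
    elim: (enum_fset X) => [|i r IH].
      by rewrite big_nil; under eq_fun do rewrite big_nil; exact: cvg_cst.
    rewrite big_cons; under eq_fun do rewrite big_cons.
    apply: cvgD; last exact: IH.
    rewrite expr2; under eq_fun do rewrite expr2.
    have uc : normc (u m i - u p i) @[p --> \oo] --> normc (u m i - g i).
      by apply: cvg_normc; apply: cvgB; [exact: cvg_cst|exact: cvg_coord].
    exact: (cvgM uc uc).
  move=> /(cvgr_to_le); apply; exists N => // p /= Np.
  have := NP _ Np; rewrite -(@ler_pXn2r _ 2) ?nnegrE ?l2norm_ge0//; last first.
    exact: le_trans (l2norm_ge0 _) (NP _ Np).
  exact: le_trans (sum_fset_l2norm _ _).
have [N0 N0P] := uC 1 ltr01.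
(* Square summability is proved for [u N0 - g], to which the estimate with radius 1 applies; the
   limit is then written as [u N0] minus this vector. *)
have wP : (fun i => u N0 i - g i) \in @ell2_pred R I.
  apply/ell2P; apply: (@le_lt_trans _ _ (1 ^+ 2)%:E); last exact: ltry.
  by apply/sqnorm_leP; apply: (bound _ N0) => p Np; apply/ltW/N0P.
exists (u N0 - Ell2 wP) => e e0.
have [N NP] := uC _ (divr_gt0 e0 (ltr0n _ 2)); exists N => m Nm.
apply: (@le_lt_trans _ _ (e / 2)); last by lra.
apply/l2norm_leP => [|X]; first by rewrite ltW// divr_gt0.
rewrite (eq_bigr (fun i => normc (u m i - g i) ^+ 2)) => [|i _].
  by apply: (bound _ N) => p Np; apply/ltW/NP.
congr (normc _ ^+ 2); rewrite -[LHS]/(u m i - (u N0 i - (u N0 i - g i))).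
by ring.
Qed.

End hilbert_topology.

(** * Words, their multisets of letters, and commutative monomials *)

Section words.
Context {R : realType} {n : nat}.
Implicit Types (a b : seq 'I_n) (k l : {ffun 'I_n -> nat}) (lam : 'rV[R[i]]_n).

(** The multiset of letters, encoded as the exponent vector of the monomial to which the word
    evaluates. *)
Definition letters a : {ffun 'I_n -> nat} := [ffun i => count_mem i a].

Lemma letters_perm a b : letters a = letters b -> perm_eq a b.
Proof. by move=> /ffunP ab; apply/allP => i _ /=; have := ab i; rewrite !ffunE => ->. Qed.

(** A canonical word with prescribed letters: it shows that [Lambda k] is nonempty and is the place
    where coefficients of symmetric vectors are read off. *)
Definition sorted_word k : seq 'I_n := \big[cat/[::]]_i nseq (k i) i.

Lemma letters_sorted_word k : letters (sorted_word k) = k.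
Proof.
apply/ffunP => i; rewrite ffunE /sorted_word.
rewrite (big_morph (count_mem i) (op1 := addn) (id1 := 0%N))//; last by move=> a b; rewrite count_cat.
rewrite (bigD1 i)//= big1 ?addn0 => [|j ji]; rewrite count_nseq/= ?eqxx ?mul1n//.
by rewrite (negbTE ji).
Qed.

Lemma word_eval_letters lam a : word_eval lam a = monomial lam (letters a).
Proof.
elim: a => [|j a IH]; rewrite /word_eval /monomial.
  by rewrite big_nil big1// => i _; rewrite ffunE expr0.
rewrite big_cons -/(word_eval lam a) IH /monomial.
under [in RHS]eq_bigr do rewrite ffunE /= exprD.
rewrite big_split/=; congr (_ * _); last by apply: eq_bigr => i _; rewrite ffunE.
rewrite (bigD1 j)//= big1 ?mulr1 ?eqxx ?expr1// => i ij.
by rewrite eq_sym (negbTE ij) expr0.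
Qed.

(** Evaluation at the point with 2 in coordinate [i] and 1 elsewhere gives 2 to the power of the
    [i]-th exponent. *)
Lemma monomial_inj k l : (forall lam, monomial lam k = monomial lam l) -> k = l.
Proof.
move=> kl; apply/ffunP => i.
have mE (m : {ffun 'I_n -> nat}) :
    monomial (\row_j (if j == i then 2 else 1) : 'rV[R[i]]_n) m = 2 ^+ m i.
  rewrite /monomial (bigD1 i)//= mxE eqxx big1 ?mulr1// => j ji.
  by rewrite mxE (negbTE ji) expr1n.
have := kl (\row_j (if j == i then 2 else 1)); rewrite !mE.
by apply: ieexprIn; rewrite ?ltr0n// pnatr_eq1.
Qed.

Lemma LambdaE k : Lambda (R := R) k = [set a | letters a = k].
Proof.
apply/seteqP; split=> a /= ak; last by move=> lam; rewrite word_eval_letters ak.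
by apply: monomial_inj => lam; rewrite -word_eval_letters.
Qed.

Lemma in_Lambda k a : (a \in fset_set (Lambda (R := R) k)) = (letters a == k).
Proof.
rewrite in_fset_set; last exact: finite_Lambda.
by rewrite LambdaE; apply/idP/eqP => [/set_mem|ak]; last exact: mem_set.
Qed.

End words.

(** * Grouping coordinates along a map, and pairing with basis vectors *)

Section regroup.
Context {R : realType} {I K : choiceType}.

Lemma esum_fiber (p : I -> K) (F : I -> \bar R) : (forall i, 0 <= F i)%E ->
  (\esum_(i in [set: I]) F i = \esum_(k in [set: K]) \esum_(i in [set i | p i = k]) F i)%E.
Proof.
move=> F0; rewrite esum_esum//.
rewrite (@reindex_esum _ _ _ [set: I] _ (fun i => (p i, i)))//.
split=> [i _|i j _ _ []//|[k i] /= [_ <-]]; first by split.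
by exists i.
Qed.

Lemma restrC (P : pred I) (u : ell2 R I) : u - restr P u = restr (predC P) u.
Proof.
apply: ell2E => i; rewrite -[LHS]/(u i - (if P i then u i else 0)) -[RHS]/(if ~~ P i then u i else 0).
by case: (P i); rewrite ?subrr ?subr0.
Qed.

Lemma restr_cvg (p : I -> K) (u : ell2 R I) :
  (fun X : {fset K} => restr (fun i => p i \in X) u) @ totally --> u.
Proof.
apply/cvgP_l2norm => e /(restr_tail u)[X0 X0P].
(* Once [X] contains the images of [X0], the coordinates left out all lie outside [X0], although the
   fibres of [p] may be infinite. *)
apply: filterS (totally_ge [fset p i | i in X0]%fset) => X /= /fsubsetP X0X.
rewrite restrC; apply: X0P => i iX0 /=; rewrite negbK.
by apply: X0X; apply/imfsetP; exists i.
Qed.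

Lemma ell2_sumE {J : Type} (r : seq J) (F : J -> ell2 R I) i :
  (\sum_(j <- r) F j) i = \sum_(j <- r) F j i.
Proof. exact: (big_morph (fun u : ell2 R I => u i)). Qed.

Lemma inner_basisr (u : ell2 R I) i : inner u (Defs.basis i) = u i.
Proof.
apply: inner_unique; apply/cvgP_normc => e e0.
apply: filterS (totally_ge [fset i]%fset) => X /=; rewrite fsub1set => iX.
rewrite partial_sumE (big_fsetD1 i)//= big_seq big1 => [|j].
  by rewrite eqxx conjC1 mulr1 addr0 subrr normc0.
by rewrite !inE => /andP[/negbTE -> _]; rewrite conjC0 mulr0.
Qed.

Lemma inner_basisl (u : ell2 R I) i : inner (Defs.basis i) u = (u i)^*.
Proof. by rewrite innerC inner_basisr. Qed.

End regroup.

(** * Letter-symmetric vectors and their expansion along the y^(k) *)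

Section symmetric_vectors.
Context {R : realType} {n : nat} (mu : weights R n).
Implicit Types (a b : seq 'I_n) (k l : {ffun 'I_n -> nat}) (f g : fock R n)
  (c : {ffun 'I_n -> nat} -> R[i]) (lam : conv_domain mu).

Definition letter_symmetric f := forall a b, letters a = letters b ->
  (bprod mu a)%:C * f a = (bprod mu b)%:C * f b.

Lemma omegaE k : omega mu k = \sum_(a <- fset_set (Lambda (R := R) k)) (bprod mu a ^+ 2)^-1.
Proof. by rewrite /omega fsbig_finite//; exact: finite_Lambda. Qed.

Lemma bprodC_neq0 a : (bprod mu a)%:C != 0 :> R[i].
Proof. by rewrite eq_complex/= eqxx andbT gt_eqF// bprod_gt0. Qed.

Lemma omega_gt0 k : 0 < omega mu k.
Proof.
rewrite omegaE (big_fsetD1 (sorted_word k))/=; last by rewrite in_Lambda letters_sorted_word.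
rewrite ltr_pwDl ?invr_gt0 ?exprn_gt0 ?bprod_gt0//.
by apply: sumr_ge0 => a _; rewrite invr_ge0 exprn_ge0// ltW// bprod_gt0.
Qed.

Lemma omegaC_neq0 k : (omega mu k)%:C != 0 :> R[i].
Proof. by rewrite eq_complex/= eqxx andbT gt_eqF// omega_gt0. Qed.

Lemma realCV (r : R) : (r^-1)%:C = (r%:C)^-1 :> R[i].
Proof. exact: fmorphV. Qed.

Lemma conj_div_real (z : R[i]) (r s : R) : (z / (r%:C * s%:C))^* = z^* / (r%:C * s%:C).
Proof. by rewrite fmorph_div rmorphM; congr (_ / (_ * _)); exact: realC_conj. Qed.

Lemma yvecE k a : yvec mu k a =
  if letters a == k then ((omega mu k)%:C * (bprod mu a)%:C)^-1 else 0.
Proof.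
rewrite /yvec fsbig_finite; last exact: finite_Lambda.
rewrite ell2ZE ell2_sumE; case: ifPn => ak.
  rewrite (big_fsetD1 a) ?in_Lambda// ell2ZE basisE eqxx mulr1 big_seq big1.
    by rewrite /= addr0 !realCV invfM.
  by move=> b; rewrite !inE => /andP[ba _]; rewrite ell2ZE basisE eq_sym (negbTE ba) mulr0.
rewrite big_seq big1 ?mulr0// => b; rewrite in_Lambda ell2ZE basisE => bk.
by case: eqVneq => [ab|_]; rewrite ?mulr0//; rewrite ab bk in ak.
Qed.

Lemma inner_yvec k g : inner (yvec mu k) g =
  (omega mu k)%:C^-1 *
  \sum_(a <- fset_set (Lambda (R := R) k)) (bprod mu a)%:C^-1 * (g a)^*.
Proof.
rewrite /yvec fsbig_finite; last exact: finite_Lambda.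
rewrite innerZl inner_suml realCV; congr (_ * _); apply: eq_bigr => a _.
by rewrite innerZl inner_basisl realCV.
Qed.

(** The coefficient of [f] along [yvec mu k]: on [Lambda k] that vector takes the value 1 / (omega_k
    mu(a, g_0)), and for symmetric [f] any word of [Lambda k] gives the same quotient. *)
Definition ycoef f k : R[i] := (omega mu k)%:C * (bprod mu (sorted_word k))%:C * f (sorted_word k).

Lemma symmetricE f a : letter_symmetric f ->
  f a = ycoef f (letters a) / ((omega mu (letters a))%:C * (bprod mu a)%:C).
Proof.
move=> /(_ a (sorted_word (letters a))); rewrite letters_sorted_word => /(_ erefl) fa.
rewrite /ycoef -(mulrA (omega mu _)%:C) -fa; field.
by rewrite bprodC_neq0 omegaC_neq0.
Qed.

(** The vectors y^(k) have disjoint supports [Lambda k], which partition the words; a partial sum of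
    the expansion is thus a truncation of [f]. *)
Lemma partial_sum_yvec f X : letter_symmetric f ->
  partial_sum (fun k => ycoef f k *: yvec mu k) X = restr (fun a => letters a \in X) f.
Proof.
move=> fs; apply: ell2E => a; rewrite partial_sumE ell2_sumE.
rewrite -[RHS]/(if letters a \in X then f a else 0); case: ifPn => aX.
  rewrite (big_fsetD1 (letters a))// ell2ZE yvecE eqxx -symmetricE// big_seq big1.
    by rewrite /= addr0.
  move=> k; rewrite !inE => /andP[ka _].
  by rewrite ell2ZE yvecE eq_sym (negbTE ka) mulr0.
rewrite big_seq big1// => k kX; rewrite ell2ZE yvecE; case: eqP => [ak|]; rewrite ?mulr0//.
by rewrite ak kX in aX.
Qed.

Lemma ycoef_cvg f : letter_symmetric f ->
  partial_sum (fun k => ycoef f k *: yvec mu k) @ totally --> f.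
Proof.
move=> fs; rewrite (_ : partial_sum _ = fun X => restr (fun a => letters a \in X) f).
  exact: restr_cvg.
by apply/funext => X; rewrite partial_sum_yvec.
Qed.

Lemma symmetric_sub_sym_fock f : letter_symmetric f -> sym_fock mu f.
Proof.
move=> fs; apply/closureP_l2norm => e /((cvgP_l2norm _ _).1 (ycoef_cvg fs))/filter_ex[X fX].
exists (partial_sum (fun k => ycoef f k *: yvec mu k) X) => //.
rewrite partial_sumE; apply: submodule_sum; first exact: submodule_lin_span.
by move=> k; apply: sub_lin_span; exists k.
Qed.

Lemma sum_Lambda_omega k :
  \sum_(a <- fset_set (Lambda (R := R) k)) ((bprod mu a)%:C * (bprod mu a)%:C)^-1 =
  (omega mu k)%:C.
Proof.
rewrite omegaE rmorph_sum/=; apply: eq_bigr => a _.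
by rewrite -[LHS]/(_^-1) -rmorphM -fmorphV/= expr2.
Qed.

Lemma inner_yvec_symmetric k g : letter_symmetric g ->
  inner (yvec mu k) g = (ycoef g k)^* / (omega mu k)%:C.
Proof.
move=> gs; rewrite inner_yvec mulrC.
(* On [Lambda k] each term is a constant times 1 / mu(a, g_0)^2, and these weights add up to
   omega_k. *)
transitivity ((omega mu k)%:C^-1 * ((ycoef g k)^* / (omega mu k)%:C *
    \sum_(a <- fset_set (Lambda (R := R) k)) ((bprod mu a)%:C * (bprod mu a)%:C)^-1)).
  rewrite mulrC; congr (_ * _); rewrite mulr_sumr big_seq [RHS]big_seq.
  apply: eq_bigr => a; rewrite in_Lambda => /eqP ak.
  rewrite (symmetricE _ gs) ak conj_div_real.
  by field; rewrite bprodC_neq0 omegaC_neq0.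
by rewrite sum_Lambda_omega; field; rewrite omegaC_neq0.
Qed.

Lemma zvecE lam a :
  zvec mu lam a = (monomial (val lam) (letters a))^* / (bprod mu a)%:C.
Proof. by rewrite -word_eval_letters. Qed.

Lemma zvec_symmetric lam : letter_symmetric (zvec mu lam).
Proof.
move=> a b ab; rewrite !zvecE ab !(mulrC (bprod mu _)%:C).
by rewrite !divfK ?bprodC_neq0.
Qed.

(** This turns expansions along the y^(k) into power series: the coefficient of z_lambda along y^(k)
    is omega_k times the conjugate monomial, and omega_k cancels against the squared norm of
    y^(k). *)
Lemma inner_yvec_zvec k lam : inner (yvec mu k) (zvec mu lam) = monomial (val lam) k.
Proof.
rewrite inner_yvec_symmetric; last exact: zvec_symmetric.
have -> : ycoef (zvec mu lam) k = (monomial (val lam) k)^* * (omega mu k)%:C.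
  rewrite /ycoef zvecE letters_sorted_word; field.
  by rewrite bprodC_neq0.
rewrite -[RHS](mulfK (omegaC_neq0 k)); congr (_ / _); rewrite rmorphM.
by congr (_ * _); [exact: conjCK|exact: realC_conj].
Qed.

Lemma funrep_cvg f c lam :
  partial_sum (fun k => c k *: yvec mu k) @ totally --> f ->
  partial_sum (fun k => c k * monomial (val lam) k) @ totally --> funrep mu f lam.
Proof.
move=> /(inner_cvgl (v := zvec mu lam)).
rewrite (_ : (fun X => inner _ _) = partial_sum (fun k => c k * monomial (val lam) k))//.
apply/funext => X; rewrite !partial_sumE inner_suml; apply: eq_bigr => k _.
by rewrite innerZl inner_yvec_zvec.
Qed.

(** Grouped by multi-degree, the words of [Lambda k] contribute |c_k|^2 / omega_k^2 times the sum
    omega_k. *)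
Lemma sqnorm_coef c :
  sqnorm (fun a => c (letters a) / ((omega mu (letters a))%:C * (bprod mu a)%:C)) =
  coef_sqnorm mu c.
Proof.
rewrite /sqnorm (esum_fiber letters) => [|a]; last by rewrite lee_fin sqr_ge0.
rewrite /coef_sqnorm; apply: eq_esum => k _.
rewrite (_ : [set i | _] = Lambda (R := R) k); last by rewrite LambdaE.
rewrite esum_fset; [|exact: finite_Lambda|by move=> a _; rewrite lee_fin sqr_ge0].
rewrite fsbig_finite; last exact: finite_Lambda.
rewrite sumEFin; congr EFin.
transitivity (\sum_(a <- fset_set (Lambda (R := R) k))
    normc (c k) ^+ 2 / omega mu k ^+ 2 * (bprod mu a ^+ 2)^-1).
  rewrite big_seq [RHS]big_seq; apply: eq_bigr => a; rewrite in_Lambda => /eqP ->.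
  rewrite normcM normcV normcM !normcC ?ltW ?bprod_gt0 ?omega_gt0//.
  by rewrite !exprMn exprVn exprMn invfM mulrA.
rewrite -mulr_sumr -omegaE; field.
by rewrite gt_eqF// omega_gt0.
Qed.

Lemma coef_sqnorm_ycoef f : letter_symmetric f ->
  coef_sqnorm mu (ycoef f) = (l2norm f ^+ 2)%:E.
Proof.
move=> fs; rewrite l2norm_sq -sqnorm_coef; congr sqnorm.
by apply/funext => a; rewrite -symmetricE.
Qed.

(** Source of surjectivity onto the function space: the norm identity makes the prescribed
    coordinates square summable. *)
Lemma symmetric_of_coef c : (coef_sqnorm mu c < +oo)%E ->
  exists2 f, letter_symmetric f & ycoef f = c.
Proof.
rewrite -sqnorm_coef => /ell2P cP; exists (Ell2 cP).
  move=> a b ab; rewrite -[Ell2 cP a]/(_ / _) -[Ell2 cP b]/(_ / _) ab.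
  by field; rewrite !bprodC_neq0 omegaC_neq0.
apply/funext => k; rewrite /ycoef -[Ell2 cP _]/(_ / _) letters_sorted_word.
by field; rewrite bprodC_neq0 omegaC_neq0.
Qed.

Lemma submodule_symmetric : submodule letter_symmetric.
Proof.
split=> [a b _|x f g fs gs a b ab]; first by rewrite !mulr0.
by rewrite !ell2DE !ell2ZE !mulrDr !(mulrCA _ x) (fs _ _ ab) (gs _ _ ab).
Qed.

(** At the word [sorted_word k] only the [k]-th term is nonzero, so this coordinate of the partial
    sums is eventually constant. *)
Lemma ycoef_unique f c : letter_symmetric f ->
  partial_sum (fun k => c k *: yvec mu k) @ totally --> f -> c = ycoef f.
Proof.
move=> fs fcvg; apply/funext => k.
have fc := inner_cvgl (v := Defs.basis (sorted_word k)) fcvg.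
have : inner (partial_sum (fun k => c k *: yvec mu k) X) (Defs.basis (sorted_word k)) @[X --> totally]
    --> c k / ((omega mu k)%:C * (bprod mu (sorted_word k))%:C).
  apply/cvgP_normc => e e0; apply: filterS (totally_ge [fset k]%fset) => X /=.
  rewrite fsub1set => kX; rewrite inner_basisr partial_sumE ell2_sumE.
  rewrite (big_fsetD1 k)// ell2ZE yvecE letters_sorted_word eqxx big_seq big1.
    by rewrite /= addr0 subrr normc0.
  by move=> l; rewrite !inE => /andP[lk _]; rewrite ell2ZE yvecE letters_sorted_word
    eq_sym (negbTE lk) mulr0.
move=> ck; have := cvg_unique (@norm_hausdorff _ _) (fc _) ck.
rewrite inner_basisr /ycoef => ->; field.
by rewrite bprodC_neq0 omegaC_neq0.
Qed.

End symmetric_vectors.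

(** * Roots of unity and orthogonality of characters *)

Section roots_of_unity.
Context {R : realType}.

(** X^N - 1 splits over the algebraically closed [R[i]] and is separable, so it has N distinct
    roots, one of which must be primitive. *)
Lemma exists_prim_root N : (0 < N)%N -> exists w : R[i], N.-primitive_root w.
Proof.
move=> N0; have [r] := closed_field_poly_normal ('X^N - 1 : {poly R[i]}).
rewrite (monicP _) ?monicXnsubC// scale1r => rE.
have rN : all N.-unity_root r by apply/allP => z; rewrite -root_prod_XsubC -rE.
have sz : (N < (size r).+1)%N by rewrite -(size_prod_XsubC r id) -rE size_XnsubC.
have [|w wr wN] := hasP (cyclic.has_prim_root N0 rN _ sz); last by exists w.
by rewrite -separable.separable_prod_XsubC -rE cyclotomic.separable_Xn_sub_1// pnatr_eq0 -lt0n.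
Qed.

Lemma prim_root_norm N (w : R[i]) : (0 < N)%N -> N.-primitive_root w -> `|w| = 1.
Proof.
move=> N0 wN; apply/eqP; rewrite -(pexpr_eq1 (n := N))// -normrX.
by rewrite (prim_expr_order wN) normr1.
Qed.

(** Conjugation inverts [w] on the unit circle, leaving a geometric sum of ratio w^(k - l), itself
    an N-th root of unity. *)
Lemma sum_prim_root N (w : R[i]) (k l : nat) : (0 < N)%N -> N.-primitive_root w ->
  \sum_(s < N) (w ^+ s) ^+ k * ((w ^+ s)^*) ^+ l = if k == l %[mod N] then N%:R else 0.
Proof.
move=> N0 wN; have w1 := prim_root_norm N0 wN.
have w0 : w != 0 by rewrite -normr_eq0 w1 oner_eq0.
have wJ : w^* = w^-1.
  by apply: (mulfI w0); rewrite divff// -normCK w1 expr1n.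
rewrite (eq_bigr (fun s : 'I_N => (w ^+ k / w ^+ l) ^+ s)) => [|s _]; last first.
  by rewrite rmorphXn/= wJ !exprMn -!exprVn -!exprM !(mulnC s).
rewrite -(eq_prim_root_expr wN); case: eqP => [->|kl].
  rewrite divff ?expf_neq0// (eq_bigr (fun=> 1)) => [|s _]; last by rewrite expr1n.
  by rewrite sumr_const card_ord.
have z1 : w ^+ k / w ^+ l - 1 != 0.
  rewrite subr_eq0; apply/eqP => h; apply: kl.
  by rewrite -[LHS](divfK (expf_neq0 l w0)) h mul1r.
apply: (mulfI z1); rewrite mulr0 -subrX1 exprMn exprVn -!exprM !(mulnC _ N) !exprM.
by rewrite (prim_expr_order wN) !expr1n divr1 subrr.
Qed.

End roots_of_unity.

(** * Each y^(k) lies in the closed span of the z_lambda *)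

Section kernel_vectors_span.
Context {R : realType} {n : nat} (mu : weights R n).

(** The hypothesis on the origin enters through this closed polydisc, which contains the tori used
    for averaging. *)
Lemma conv_domain_polydisc : nbhs (0 : 'rV[R[i]]_n) (conv_domain mu) ->
  exists2 r : R, 0 < r &
    forall lam : 'rV[R[i]]_n, (forall i, normc (lam 0 i) <= r) -> conv_domain mu lam.
Proof.
move=> /nbhs_ballP[[e e'] /= e0 eD].
have e'0 : e' = 0 by move: e0; rewrite ltcE /= => /andP[/eqP].
move: e0 eD; rewrite e'0 ltcR => e0 eD.
exists (e / 2); first by rewrite divr_gt0.
move=> lam lr; apply: eD; split=> [|i j]; first by rewrite ltcR.
rewrite -ball_normE /ball_/= mxE sub0r normrN ord1 ltcR.
by apply: le_lt_trans (lr j) _; lra.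
Qed.

Section average.
Variables (r : R) (N : nat) (w : R[i]).
Hypotheses (r_ge0 : 0 <= r) (N_gt0 : (0 < N)%N) (wN : N.-primitive_root w).
Hypothesis r_domain :
  forall lam : 'rV[R[i]]_n, (forall i, normc (lam 0 i) <= r) -> conv_domain mu lam.

Definition torus_point (t : {ffun 'I_n -> 'I_N}) : 'rV[R[i]]_n :=
  \row_i (r%:C * w ^+ t i).

Lemma torus_point_domain t : torus_point t \in conv_domain mu.
Proof.
apply/mem_set/r_domain => i; rewrite mxE.
rewrite -lecR -[leLHS]/(`|r%:C * w ^+ t i|) normrM normrX (prim_root_norm N_gt0 wN).
by rewrite expr1n mulr1 ger0_norm// ler0c.
Qed.

Lemma const_domain : (const_mx r%:C : 'rV[R[i]]_n) \in conv_domain mu.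
Proof. by apply/mem_set/r_domain => i; rewrite mxE normcC. Qed.

Definition radial_zvec : fock R n := zvec mu (Sub (const_mx r%:C) const_domain).

Lemma radial_zvecE a : radial_zvec a = (\prod_i r%:C ^+ letters a i) / (bprod mu a)%:C.
Proof.
rewrite zvecE /monomial rmorph_prod; congr (_ / _); apply: eq_bigr => i _.
by rewrite mxE rmorphXn; congr (_ ^+ _); exact: realC_conj.
Qed.

Lemma torus_average (k : {ffun 'I_n -> nat}) :
  \sum_(t : {ffun 'I_n -> 'I_N}) ((N%:R ^+ n)^-1 * \prod_i (w ^+ t i) ^+ k i) *:
      zvec mu (Sub (torus_point t) (torus_point_domain t)) =
  restr (fun a => [forall i, k i == letters a i %[mod N]]) radial_zvec.
Proof.
apply: ell2E => a; rewrite ell2_sumE.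
rewrite -[RHS]/(if _ then radial_zvec a else 0) radial_zvecE.
transitivity ((N%:R ^+ n)^-1 / (bprod mu a)%:C * \sum_(t : {ffun 'I_n -> 'I_N})
    \prod_i ((w ^+ t i) ^+ k i * (r%:C * (w ^+ t i)^*) ^+ letters a i)).
  rewrite mulr_sumr; apply: eq_bigr => t _; rewrite ell2ZE zvecE.
  have -> : (monomial (torus_point t) (letters a))^* =
      \prod_i (r%:C * (w ^+ t i)^*) ^+ letters a i.
    rewrite /monomial rmorph_prod; apply: eq_bigr => i _.
    by rewrite mxE rmorphXn rmorphM; congr ((_ * _) ^+ _); exact: realC_conj.
  by rewrite big_split/=; ring.
(* The sum over the torus factors into one character sum per coordinate, each equal to N or 0 up to
   a power of [r]. *)
rewrite -(bigA_distr_bigA (fun i (s : 'I_N) => (w ^+ s) ^+ k i * (r%:C * (w ^+ s)^*) ^+ letters a i)).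
rewrite (eq_bigr (fun i => r%:C ^+ letters a i *
    if k i == letters a i %[mod N] then N%:R else 0)) => [|i _]; last first.
  rewrite -(sum_prim_root _ _ N_gt0 wN) mulr_sumr; apply: eq_bigr => s _.
  by rewrite exprMn mulrCA.
rewrite big_split/=; case: ifPn => [/forallP ka|].
  rewrite [X in _ * (_ * X)](eq_bigr (fun=> N%:R)) => [|i _]; last by rewrite ka.
  rewrite prodr_const card_ord.
  by field; rewrite bprodC_neq0 expf_neq0// pnatr_eq0 -lt0n.
rewrite negb_forall => /existsP[i ki].
by rewrite [X in _ * (_ * X)](bigD1 i)//= (negbTE ki) mul0r !mulr0.
Qed.

End average.

(** For [r] > 0 the scalar is nonzero, so y^(k) is recovered from this component. *)
Lemma radial_zvec_component (r : R) (r0 : 0 <= r) rD (k : {ffun 'I_n -> nat}) :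
  restr (fun a => letters a == k) (radial_zvec r0 rD) =
  (r%:C ^+ (\sum_i k i) * (omega mu k)%:C) *: yvec mu k.
Proof.
apply: ell2E => a; rewrite ell2ZE yvecE -[LHS]/(if _ then radial_zvec r0 rD a else 0).
case: eqP => [ak|]; last by rewrite mulr0.
rewrite radial_zvecE ak.
by rewrite prodrXr; field; rewrite bprodC_neq0 omegaC_neq0.
Qed.

(* Averaging the vectors z at the points r (w^{t_1}, .., w^{t_n}), for w a
   primitive N-th root of unity, against the characters of the torus retains
   the components of z_(r, .., r) of multi-degree congruent to k modulo N; for
   large N all of them but the one of multi-degree k are negligible. *)
Lemma yvec_closed_span_zvec (k : {ffun 'I_n -> nat}) :
  nbhs (0 : 'rV[R[i]]_n) (conv_domain mu) -> closed_span (range (zvec mu)) (yvec mu k).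
Proof.
move=> /conv_domain_polydisc[r r0 rD]; have r_ge0 := ltW r0.
have rk0 : r%:C ^+ (\sum_i k i) * (omega mu k)%:C != 0.
  by rewrite mulf_neq0 ?omegaC_neq0// expf_neq0// eq_complex/= eqxx andbT gt_eqF.
suff : closed_span (range (zvec mu)) (restr (fun a => letters a == k) (radial_zvec r_ge0 rD)).
  move=> /(submoduleZ (r%:C ^+ (\sum_i k i) * (omega mu k)%:C)^-1 (submodule_closed_span _)).
  by rewrite radial_zvec_component scalerA mulVf// scale1r.
apply/closureP_l2norm => e /(restr_tail (radial_zvec r_ge0 rD))[X0 X0P].
(* [N] exceeds every exponent [k i] and the length of every word in [X0]; on [X0], congruence modulo
   [N] is therefore equality of multi-degrees. *)
pose N := (\sum_i k i + \sum_(a <- X0) size a).+1.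
have [w wN] := @exists_prim_root R N (ltn0Sn _).
exists (restr (fun a => [forall i, k i == letters a i %[mod N]]) (radial_zvec r_ge0 rD)).
  rewrite -(torus_average r_ge0 (ltn0Sn _) wN rD); apply: submodule_sum.
    exact: submodule_lin_span.
  by move=> t; apply: sub_lin_span; eexists.
have kN i : (k i < N)%N.
  by rewrite ltnS (bigD1 i)//= -addnA leq_addr.
have -> : restr (fun a => letters a == k) (radial_zvec r_ge0 rD) -
    restr (fun a => [forall i, k i == letters a i %[mod N]]) (radial_zvec r_ge0 rD) =
    (-1 : R[i]) *: restr (fun a => (letters a != k) && [forall i, k i == letters a i %[mod N]])
      (radial_zvec r_ge0 rD).
  apply: ell2E => a; rewrite ell2ZE.
  rewrite -[LHS]/((if _ then _ else 0) - (if _ then _ else 0)).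
  rewrite -[X in _ = _ * X]/(if _ then _ else 0).
  case: eqP => [->|_] /=.
    by rewrite mulr0 ifT ?subrr//; apply/forallP.
  by rewrite sub0r mulN1r.
rewrite l2normZ normcN normc1 mul1r; apply: X0P => a aX0; rewrite negb_and negbK.
case: forallP => [ka|]; rewrite ?orbT//= orbF; apply/eqP/ffunP => i.
have aN : (letters a i < N)%N.
  rewrite ltnS ffunE (leq_trans (count_size _ _))// (big_fsetD1 a)//=.
  by rewrite addnCA leq_addr.
by have /eqP := ka i; rewrite !modn_small.
Qed.

End kernel_vectors_span.

(** * Invariance under adjacent transpositions implies invariance under permutations *)

Section adjacent_swaps.
Context {T : eqType} {V : Type} (G : seq T -> V).
Hypothesis swap : forall a b i j, G (a ++ i :: j :: b) = G (a ++ j :: i :: b).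

Lemma swap_move a b i x : G (x ++ i :: a ++ b) = G (x ++ a ++ i :: b).
Proof.
elim: a x => [//|j a IH] x; rewrite /= swap.
by have := IH (rcons x j); rewrite !cat_rcons.
Qed.

Lemma swap_perm a b : perm_eq a b -> G a = G b.
Proof.
(* The prefix [x] collects the letters already matched during the induction. *)
suff H x : perm_eq a b -> G (x ++ a) = G (x ++ b) by exact: (H [::]).
elim: a b x => [|i a IH] b x ab; first by rewrite perm_sym in ab; rewrite (perm_nilP ab).
have ib : i \in b by rewrite -(perm_mem ab) mem_head.
case/splitPr: ib ab => b1 b2; rewrite perm_sym -cat1s perm_catCA cat1s perm_cons perm_sym => ab.
by rewrite -swap_move; have := IH _ (rcons x i) ab; rewrite !cat_rcons.
Qed.

End adjacent_swaps.

(** * Bounded operators form an algebra *)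

Section bounded_operators.
Context {K : numFieldType} {V : normedModType K}.
Implicit Types A B : V -> V.

Lemma bounded_op_id : bounded_op (@idfun V).
Proof. by split=> //; exists 1 => v; rewrite mul1r. Qed.

(** A nonzero vector forces the given bound to be nonnegative, and at 0 any constant serves; hence
    its absolute value always works. *)
Lemma bounded_op_bound A : bounded_op A -> exists2 M : K, 0 <= M & forall v, `|A v| <= M * `|v|.
Proof.
move=> [Al [M AM]]; exists `|M| => // v.
have := AM v; have [->|v0] := eqVneq v 0; first by rewrite normr0 !mulr0.
move=> AvM; rewrite ger0_norm// -(@pmulr_lge0 _ `|v|) ?normr_gt0//.
by apply: le_trans AvM.
Qed.

Lemma bounded_op_lin (a : K) A B :
  bounded_op A -> bounded_op B -> bounded_op (a *: A + B).
Proof.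
move=> Ab Bb; have [M _ AM] := bounded_op_bound Ab; have [N _ BN] := bounded_op_bound Bb.
split=> [c u v|].
  rewrite -[LHS]/(a *: A (c *: u + v) + B (c *: u + v)).
  rewrite -[RHS]/(c *: (a *: A u + B u) + (a *: A v + B v)) Ab.1 Bb.1.
  by rewrite !scalerDr !scalerA (mulrC a) addrACA.
exists (`|a| * M + N) => v; rewrite -[X in `|X|]/(a *: A v + B v).
apply: le_trans (ler_normD _ _) _.
by rewrite normrZ mulrDl lerD// -mulrA ler_wpM2l.
Qed.

Lemma bounded_op_comp A B : bounded_op A -> bounded_op B -> bounded_op (A \o B).
Proof.
move=> Ab Bb; have [M M0 AM] := bounded_op_bound Ab; have [N _ BN] := bounded_op_bound Bb.
split=> [c u v|]; first by rewrite /= Bb.1 Ab.1.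
by exists (M * N) => v; rewrite -mulrA (le_trans (AM _))// ler_wpM2l.
Qed.

End bounded_operators.

(** * Matrix coefficients as w*-continuous functionals, and operators whose adjoint fixes a line *)

Section weak_star.
Context {R : realType} {I : choiceType}.
Local Notation H := (ell2 R I).
Implicit Types (A B : H -> H) (S : set (H -> H)) (f g : H).

Lemma wstar_closureS S S' : S `<=` S' -> wstar_closure S `<=` wstar_closure S'.
Proof.
move=> SS' A [Ab AS]; split=> // m x y e e0 xy.
by have [B SB AB] := AS m x y e e0 xy; exists B => //; exact: SS'.
Qed.

(** Concentrating the square summable sequences in one term reduces a trace pairing to one matrix
    coefficient. *)
Definition single f : nat -> H := fun k => if k == 0 then f else 0.

Lemma sq_summable_single f : sq_summable (single f).
Proof.
rewrite /sq_summable; apply: (@le_lt_trans _ _ (l2norm f ^+ 2)%:E); last exact: ltry.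
apply/esum_fsetP => [k|X]; first exact: sqr_ge0.
rewrite lee_fin; have [X0|X0] := boolP (0%N \in X).
  rewrite (big_fsetD1 0%N)//= big_seq big1 ?addr0// => k.
  rewrite !inE /single => /andP[/negbTE -> _].
  by have := l2normZ 0 (0 : H); rewrite scaler0 normc0 mul0r => ->; rewrite expr0n.
rewrite big_seq big1 ?sqr_ge0// => k kX; rewrite /single; case: eqP => [k0|_].
  by rewrite k0 (negbTE X0) in kX.
by have := l2normZ 0 (0 : H); rewrite scaler0 normc0 mul0r => ->; rewrite expr0n.
Qed.

Lemma inner0r f : inner f 0 = 0.
Proof. by rewrite innerC inner0l conjC0. Qed.

Lemma trace_pairing_single f g A : trace_pairing (single f) (single g) A = inner (A f) g.
Proof.
apply: (cvg_lim (@norm_hausdorff _ _)); apply/cvgP_normc => e e0.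
apply: filterS (totally_ge [fset 0%N]%fset) => X /=; rewrite fsub1set => X0.
rewrite partial_sumE (big_fsetD1 0%N)//= big_seq big1 => [|k].
  by rewrite addr0 subrr normc0.
by rewrite !inE /single => /andP[/negbTE -> _]; rewrite inner0r.
Qed.

Lemma wstar_closure_approx S A f g f' g' (e : R) : wstar_closure S A -> 0 < e ->
  exists2 B, S B &
    normc (inner (A f - B f) g) < e /\ normc (inner (A f' - B f') g') < e.
Proof.
move=> [_ AS] e0.
pose x (h h' : H) (j : 'I_2) := if j == 0 then single h else single h'.
have xy j : sq_summable (x f f' j) /\ sq_summable (x g g' j).
  by rewrite /x; case: (j == 0); split; exact: sq_summable_single.
have [B SB AB] := AS 2%N _ _ e e0 xy.
by exists B => //; split; [have := AB 0|have := AB 1]; rewrite trace_pairing_single.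
Qed.

(** The operators whose adjoint has [g] as an eigenvector, phrased without adjoints. *)
Definition eigen_ops g : set (H -> H) :=
  [set A | bounded_op A /\ exists c : R[i], forall f, inner (A f) g = c * inner f g].

Lemma eigen_ops_unital_subalgebra g : unital_subalgebra (eigen_ops g).
Proof.
split=> [A []//||a A B [Ab [c Ac]] [Bb [d Bd]]|A B [Ab [c Ac]] [Bb [d Bd]]].
- by split; [exact: bounded_op_id|exists 1 => f; rewrite mul1r].
- split; first exact: bounded_op_lin.
  exists (a * c + d) => f; rewrite -[X in inner X]/(a *: A f + B f).
  by rewrite inner_linear Ac Bd mulrDl mulrA.
- split; first exact: bounded_op_comp.
  by exists (c * d) => f; rewrite /= Ac Bd mulrA.
Qed.

(** Since <v, g> = 1, the eigenvalue has to be <A v, g>; the eigenvector equation then involves just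
    two matrix coefficients of [A], which are approximated simultaneously. *)
Lemma eigen_ops_wstar_closed g v : inner v g = 1 -> wstar_closed (eigen_ops g).
Proof.
move=> vg A AE; split; first exact: AE.1.
exists (inner (A v) g) => f; apply/eqP; rewrite -subr_eq0; apply/eqP/eq0_normc.
apply/eqP; rewrite eq_le normc_ge0 andbT; apply/ler_addgt0Pr => e e0; rewrite add0r.
pose M := 1 + normc (inner f g).
have M0 : 0 < M by rewrite ltr_wpDr ?normc_ge0.
have [B [_ [c Bc]] [ABf ABv]] := wstar_closure_approx f g v g AE (divr_gt0 e0 M0).
(* The contributions of [B] cancel; the errors e / M, the second one multiplied by |<f, g>|, add up
   to at most [e] by the choice of [M]. *)
have -> : inner (A f) g - inner (A v) g * inner f g =
    inner (A f - B f) g - inner (A v - B v) g * inner f g.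
  by rewrite !innerBl !Bc vg; ring.
apply: le_trans (ler_normcD _ _) _; rewrite normcN normcM.
rewrite -[leRHS](divfK (lt0r_neq0 M0)) /M mulrDr mulr1.
by rewrite lerD ?ler_wpM2r ?normc_ge0 ?ltW.
Qed.

End weak_star.

(** * The Hardy algebra, its commutator ideal, and the orthogonal complement of J_c(1) *)

Section commutator_ideal.
Context {R : realType} {n : nat} (mu : weights R n).
Local Notation H := (fock R n).
Implicit Types (f g : H) (A B : H -> H) (a b : seq 'I_n) (lam : conv_domain mu).

Lemma l2norm_shift i : exists2 M : R, 0 <= M & forall f, l2norm (Defs.shift mu i f) <= M * l2norm f.
Proof.
have [M MP] := weight_left_bounded mu i.
have M0 : 0 <= M.
  by apply: le_trans (ltW (weight_gt0 mu (_ : [:: i] != [::]))) (MP _ _) => //; exists [::].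
exists M => // f; apply/l2norm_leP; first by rewrite mulr_ge0 ?l2norm_ge0.
apply/sqnorm_leP; rewrite exprMn EFinM l2norm_sq.
rewrite /sqnorm (esumID (range (cons i))) => [|b _]; last by rewrite lee_fin sqr_ge0.
rewrite [X in (_ + X)%E]esum1 ?adde0 ?setTI; last first.
  case=> [|j a] ja; first by rewrite shiftE normc0 expr0n.
  rewrite shiftE /shift_coef; case: eqVneq => [ji|_]; last by rewrite normc0 expr0n.
  by exfalso; apply: ja; exists a; rewrite ?ji.
rewrite (@reindex_esum _ _ _ setT _ (cons i)); last first.
  by split => [a _|a b _ _ []|_ [a _ <-]]//; exists a.
apply: (@sqnorm_bound _ _ M (fun a => Defs.shift mu i f (i :: a)) f M0) => a.
rewrite shiftE /shift_coef eqxx normcM ler_wpM2r ?normc_ge0//.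
rewrite normcC ?(ltW (weight_gt0 mu (isT : i :: a != [::])))//.
by apply: MP; exists a.
Qed.

Lemma bounded_shift i : bounded_op (Defs.shift mu i).
Proof.
split; first exact: shift_linear.
have [M M0 MP] := l2norm_shift i; exists M%:C => f.
by rewrite -[leRHS](rmorphM (real_complex R)) lecR.
Qed.

Lemma fock_basis_cvg f : partial_sum (fun a => f a *: Defs.basis a) @ totally --> f.
Proof.
rewrite (_ : partial_sum _ = fun X : {fset seq 'I_n} => restr (fun a => a \in X) f).
  exact: (restr_cvg id).
apply/funext => X; apply: ell2E => a; rewrite partial_sumE ell2_sumE.
rewrite -[RHS]/(if a \in X then f a else 0); case: ifPn => aX.
  rewrite (big_fsetD1 a)// ell2ZE basisE eqxx mulr1 big_seq big1; first by rewrite /= addr0.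
  by move=> b; rewrite !inE => /andP[ba _]; rewrite ell2ZE basisE eq_sym (negbTE ba) mulr0.
rewrite big_seq big1// => b bX; rewrite ell2ZE basisE; case: eqP => [ab|]; rewrite ?mulr0//.
by rewrite ab bX in aX.
Qed.

Lemma shift_cvg i {T} {F : set_system T} {FF : Filter F} (u : T -> H) f :
  u @ F --> f -> Defs.shift mu i (u t) @[t --> F] --> Defs.shift mu i f.
Proof.
have [M M0 MP] := l2norm_shift i.
move=> /cvgP_l2norm uf; apply/cvgP_l2norm => e e0.
have M1 : 0 < M + 1 by rewrite ltr_wpDl.
have := uf _ (divr_gt0 e0 M1); apply: filterS => t; rewrite ltr_pdivlMr// mulrC.
apply: le_lt_trans; rewrite addrC -scaleN1r -shift_linear scaleN1r addrC.
by apply: le_trans (MP _) _; rewrite ler_wpM2r ?l2norm_ge0// lerDl.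
Qed.

Lemma realCM (r s : R) : (r * s)%:C = r%:C * s%:C :> R[i].
Proof. exact: (rmorphM (real_complex R)). Qed.

Lemma conj_zvec lam a : (zvec mu lam a)^* = word_eval (val lam) a / (bprod mu a)%:C.
Proof.
rewrite -[zvec mu lam a]/((word_eval _ _)^* / _) fmorph_div.
by congr (_ / _); [exact: conjCK|exact: realC_conj].
Qed.

(** This is W_i^* z_lambda = conj(lambda_i) z_lambda. On basis vectors the weight of W_i cancels the
    first factor of mu(g_i alpha, g_0); continuity of both sides does the rest. *)
Lemma inner_shift_zvec i f lam :
  inner (Defs.shift mu i f) (zvec mu lam) = val lam 0 i * inner f (zvec mu lam).
Proof.
pose P := partial_sum (fun a => f a *: Defs.basis a).
have h1 : inner (Defs.shift mu i (P X)) (zvec mu lam) @[X --> totally] -->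
    inner (Defs.shift mu i f) (zvec mu lam).
  by apply: inner_cvgl; apply: shift_cvg; exact: fock_basis_cvg.
have h2 : val lam 0 i *: inner (P X) (zvec mu lam) @[X --> totally] -->
    val lam 0 i *: inner f (zvec mu lam).
  by apply: cvgZl_tmp; apply: inner_cvgl; exact: fock_basis_cvg.
rewrite -[RHS]/(val lam 0 i *: inner f (zvec mu lam)).
suff PE : (fun X => inner (Defs.shift mu i (P X)) (zvec mu lam)) =
    (fun X => val lam 0 i *: inner (P X) (zvec mu lam)).
  by move: h1; rewrite PE => h1; exact: (cvg_unique (@norm_hausdorff _ _) h1 h2).
rewrite {h1 h2}/P.
apply/funext => X; rewrite /= !partial_sumE.
have -> : Defs.shift mu i (\sum_(a <- X) f a *: Defs.basis a) =
    \sum_(a <- X) f a *: Defs.shift mu i (Defs.basis a).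
  elim: (enum_fset X) => [|a r IH]; last by rewrite !big_cons shift_linear IH.
  rewrite !big_nil; have := Defs.shift_linear mu i (-1) 0 0.
  by rewrite scaler0 addr0 scaleN1r addNr.
rewrite !inner_suml scaler_sumr; apply: eq_bigr => a _.
rewrite shift_basis !innerZl !inner_basisl.
rewrite !conj_zvec /word_eval big_cons /= realCM; rewrite -[RHS]/(_ * (_ * _)).
field; rewrite bprodC_neq0 eq_complex/= eqxx andbT gt_eqF//.
exact: weight_gt0.
Qed.

Definition shifts a f : H := foldr (Defs.shift mu) f a.

Lemma shifts_basis a b :
  (bprod mu b)%:C *: shifts a (Defs.basis b) = (bprod mu (a ++ b))%:C *: Defs.basis (a ++ b).
Proof.
elim: a => [//|i a IH] /=.
have shiftZ (c : R[i]) f : Defs.shift mu i (c *: f) = c *: Defs.shift mu i f.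
  by apply: ell2E => -[|j x]; rewrite ell2ZE !shiftE /shift_coef ?mulr0//;
    case: eqP => _; rewrite ?mulr0// ell2ZE mulrCA.
by rewrite -shiftZ IH shiftZ shift_basis scalerA realCM mulrC.
Qed.

Lemma shifts_vacuum a : shifts a (vacuum (n := n)) = (bprod mu a)%:C *: Defs.basis a.
Proof. by have := shifts_basis a [::]; rewrite cats0 scale1r. Qed.

Lemma shiftsB a f g : shifts a (f - g) = shifts a f - shifts a g.
Proof.
elim: a => [//|i a IH] /=.
by rewrite IH addrC -scaleN1r shift_linear scaleN1r addrC.
Qed.

(** The bounded operators are themselves a w*-closed unital algebra containing the shifts, hence one
    of the sets being intersected. *)
Lemma hardy_bounded : hardy mu `<=` bounded_op.
Proof.
move=> A; apply; split; last by move=> _ [i _ <-]; exact: bounded_shift.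
split; last by move=> B [].
by split=> //; [exact: bounded_op_id|exact: bounded_op_lin|exact: bounded_op_comp].
Qed.

Lemma hardy_unital_subalgebra : unital_subalgebra (hardy mu).
Proof.
split; first exact: hardy_bounded.
- by move=> F [[[_ + _ _] _] _].
- move=> a A B hA hB F FP; have [[[_ _ Fl _] _] _] := FP.
  by apply: Fl; [exact: hA|exact: hB].
- move=> A B hA hB F FP; have [[[_ _ _ Fc] _] _] := FP.
  by apply: Fc; [exact: hA|exact: hB].
Qed.

Lemma hardy_wstar_closed : wstar_closed (hardy mu).
Proof.
move=> A hA F FP; have [[_ Fc] _] := FP; apply: Fc.
by move: A hA; apply: wstar_closureS => A; apply.
Qed.

Lemma shift_hardy i : hardy mu (Defs.shift mu i).
Proof. by move=> F [_ sF]; apply: sF; exists i. Qed.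

Lemma shifts_hardy a : hardy mu (shifts a).
Proof.
have [_ hid _ hcomp] := hardy_unital_subalgebra.
elim: a => [//|i a IH].
by have := hcomp _ _ (shift_hardy i) IH.
Qed.

Lemma inner_vacuum_zvec lam : inner (vacuum (n := n)) (zvec mu lam) = 1.
Proof. by rewrite inner_basisl conj_zvec /word_eval big_nil divr1. Qed.

Lemma hardy_eigen lam : hardy mu `<=` eigen_ops (zvec mu lam).
Proof.
move=> A; apply; split.
  split; first exact: eigen_ops_unital_subalgebra.
  exact: eigen_ops_wstar_closed (inner_vacuum_zvec lam).
move=> _ [i _ <-]; split; first exact: bounded_shift.
by exists (val lam 0 i) => f; rewrite inner_shift_zvec.
Qed.

Definition annihilators g : set (H -> H) :=
  [set A | hardy mu A /\ forall f, inner (A f) g = 0].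

(** Stability under multiplication on the left uses the eigenvector property, <A B f, z> = c <B f,
    z>; on the right it is immediate because [f] is arbitrary. *)
Lemma annihilators_ideal lam : two_sided_ideal (hardy mu) (annihilators (zvec mu lam)).
Proof.
have [_ hid hlin hcomp] := hardy_unital_subalgebra.
split=> [A []//||a A B [hA A0] [hB B0]|A B hA [hB B0]].
- split=> [|f]; last by rewrite inner0l.
  by have := hlin (-1) _ _ hid hid; rewrite scaleN1r addNr.
- split=> [|f]; first exact: hlin.
  rewrite -[X in inner X]/(a *: A f + B f).
  by rewrite inner_linear A0 B0 mulr0 addr0.
- have [_ [c Ac]] := hardy_eigen lam hA.
  split; split=> [|f]; [exact: hcomp| |exact: hcomp|]; rewrite /= ?B0//.
  by rewrite Ac B0 mulr0.
Qed.

Lemma annihilators_wstar_closed lam : wstar_closed (annihilators (zvec mu lam)).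
Proof.
move=> A AJ; split.
  by apply: hardy_wstar_closed; move: A AJ; apply: wstar_closureS => A [].
move=> f; apply/eq0_normc/eqP; rewrite eq_le normc_ge0 andbT.
apply/ler_addgt0Pr => e e0; rewrite add0r.
have [B [_ B0] [ABf _]] := wstar_closure_approx f (zvec mu lam) f (zvec mu lam) AJ e0.
by move: ABf; rewrite innerBl B0 subr0 => /ltW.
Qed.

Lemma commutator_hardy i j :
  hardy mu ((Defs.shift mu i \o Defs.shift mu j) - (Defs.shift mu j \o Defs.shift mu i)).
Proof.
have [_ hid hlin hcomp] := hardy_unital_subalgebra.
rewrite addrC -scaleN1r; apply: hlin; apply: hcomp; exact: shift_hardy.
Qed.

Lemma commutator_ideal_annihilators lam :
  commutator_ideal mu `<=` annihilators (zvec mu lam).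
Proof.
move=> A; apply; split.
  by split; [exact: annihilators_ideal|exact: annihilators_wstar_closed].
move=> _ [i [j ->]]; split; first exact: commutator_hardy.
move=> f; rewrite -[X in inner X]/(Defs.shift mu i (Defs.shift mu j f) -
  Defs.shift mu j (Defs.shift mu i f)).
by rewrite innerBl !inner_shift_zvec mulrCA subrr.
Qed.

Lemma zvec_orth_ideal lam : orth_compl (ideal_at_vacuum mu) (zvec mu lam).
Proof.
move=> _ [A JA <-]; have [_ A0] := commutator_ideal_annihilators lam JA.
by rewrite innerC A0 conjC0.
Qed.

Lemma ideal_at_vacuum_swap a b i j :
  ideal_at_vacuum mu (shifts (a ++ i :: j :: b) (vacuum (n := n)) -
                      shifts (a ++ j :: i :: b) (vacuum (n := n))).
Proof.
pose D := (Defs.shift mu i \o Defs.shift mu j) - (Defs.shift mu j \o Defs.shift mu i).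
(* The operator W_a [W_i, W_j] W_b lies in every ideal that contains the commutators. *)
exists (shifts a \o (D \o shifts b)).
  move=> J JP; have [[[_ _ _ Jm] _] Jc] := JP.
  have JD : J D by apply: Jc; exists i, j.
  have [_ JDb] := Jm _ _ (shifts_hardy b) JD.
  by have [] := Jm _ _ (shifts_hardy a) JDb.
rewrite /shifts !foldr_cat -!/(shifts _ _) /=.
by rewrite -shiftsB.
Qed.

Lemma orth_ideal_symmetric f : orth_compl (ideal_at_vacuum mu) f -> letter_symmetric mu f.
Proof.
move=> fJ a b /letters_perm.
apply: (swap_perm (G := fun x => (bprod mu x)%:C * f x)) => {}a {}b i j; apply/eqP.
have /eqP := fJ _ (ideal_at_vacuum_swap a b i j).
rewrite !shifts_vacuum innerBr !innerZr !inner_basisr.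
by rewrite ![(_%:C)^*]realC_conj subr_eq0.
Qed.

End commutator_ideal.

(** * Equality of the spaces, and transport of the Hilbert structure to functions *)

Section hardy_space.
Context {R : realType} {n : nat} (mu : weights R n).
Hypothesis mu_nbhs : nbhs (0 : 'rV[R[i]]_n) (conv_domain mu).
Implicit Types (f g : fock R n) (c d : {ffun 'I_n -> nat} -> R[i]) (lam : conv_domain mu)
  (phi psi : conv_domain mu -> R[i]).

Lemma sym_fock_sub_zvec : sym_fock mu `<=` closed_span (range (zvec mu)).
Proof.
by apply: closed_span_sub => _ [k _ <-]; exact: yvec_closed_span_zvec.
Qed.

Lemma closed_span_zvec_sub_orth :
  closed_span (range (zvec mu)) `<=` orth_compl (ideal_at_vacuum mu).
Proof.
apply: closed_span_min; [exact: submodule_orth_compl|exact: closure_orth_compl|].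
by move=> _ [lam _ <-]; exact: zvec_orth_ideal.
Qed.

Lemma sym_fockE : sym_fock mu = letter_symmetric mu.
Proof.
apply/seteqP; split; last by move=> f; exact: symmetric_sub_sym_fock.
by move=> f /sym_fock_sub_zvec /closed_span_zvec_sub_orth /orth_ideal_symmetric.
Qed.

Lemma closed_span_zvecE : closed_span (range (zvec mu)) = letter_symmetric mu.
Proof.
apply/seteqP; split=> f; first by move=> /closed_span_zvec_sub_orth /orth_ideal_symmetric.
by rewrite -sym_fockE; exact: sym_fock_sub_zvec.
Qed.

Lemma orth_idealE : orth_compl (ideal_at_vacuum mu) = letter_symmetric mu.
Proof.
apply/seteqP; split=> f; first exact: orth_ideal_symmetric.
by rewrite -closed_span_zvecE; exact: closed_span_zvec_sub_orth.
Qed.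

Lemma closure_symmetric : closure (letter_symmetric mu) `<=` letter_symmetric mu.
Proof. by rewrite -orth_idealE; exact: closure_orth_compl. Qed.

Lemma funrep_linear (a : R[i]) f g : funrep mu (a *: f + g) = a *: funrep mu f + funrep mu g.
Proof. by apply/funext => lam; rewrite /funrep inner_linear. Qed.

Lemma funrepB f g : funrep mu (f - g) = funrep mu f - funrep mu g.
Proof. by rewrite addrC -scaleN1r funrep_linear scaleN1r addrC. Qed.

Lemma funrep0 : funrep mu 0 = 0.
Proof. by apply/funext => lam; rewrite /funrep inner0l. Qed.

(** The difference [h] is orthogonal to every z_lambda, hence to their closed span, which contains
    [h] itself; so its norm vanishes. *)
Lemma funrep_inj : set_inj (letter_symmetric mu) (funrep mu).
Proof.
move=> f g /set_mem fs /set_mem gs fg; apply/eqP; rewrite -subr_eq0; apply/eqP.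
have hs : letter_symmetric mu (f - g) by exact: submoduleB (submodule_symmetric mu) fs gs.
have h0 : funrep mu (f - g) = 0 by rewrite funrepB fg subrr.
move: (f - g) hs h0 => h hs h0.
have : orth_compl [set h] h.
  rewrite -closed_span_zvecE in hs; move: h hs h0 => h hs h0.
  suff : closed_span (range (zvec mu)) `<=` orth_compl [set h] by apply.
  apply: closed_span_min; [exact: submodule_orth_compl|exact: closure_orth_compl|].
  move=> _ [lam _ <-] _ ->; rewrite innerC.
  by have := congr1 (@^~ lam) h0; rewrite /funrep => ->; exact: conjC0.
move=> /(_ h erefl); rewrite inner_l2norm => -[] /eqP; rewrite sqrf_eq0 => /eqP.
exact: l2norm_eq0.
Qed.

Lemma power_series_rep_ycoef f : letter_symmetric mu f ->
  power_series_rep mu (funrep mu f) (ycoef mu f).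
Proof.
move=> fs; split=> [lam|]; first exact/funrep_cvg/ycoef_cvg.
by rewrite coef_sqnorm_ycoef// ltry.
Qed.

(** The coefficients define a symmetric vector whose function is the sum of the same series, so
    limits agree pointwise. *)
Lemma power_series_repE phi c : power_series_rep mu phi c ->
  exists f, [/\ letter_symmetric mu f, funrep mu f = phi & ycoef mu f = c].
Proof.
move=> [cphi /symmetric_of_coef[f fs fc]]; exists f; split=> //; apply/funext => lam.
have [fcvg _] := power_series_rep_ycoef fs.
by have := cphi lam; rewrite -fc => /(cvg_unique (@norm_hausdorff _ _) (fcvg lam)).
Qed.

Lemma power_series_rep_unique phi c d :
  power_series_rep mu phi c -> power_series_rep mu phi d -> c = d.
Proof.
move=> /power_series_repE[f [fs <- <-]] /power_series_repE[g [gs gf <-]].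
by congr ycoef; apply: funrep_inj => //; exact: mem_set.
Qed.

Lemma H2P phi : H2 mu phi <-> exists2 f, letter_symmetric mu f & phi = funrep mu f.
Proof.
split=> [[c /power_series_repE[f [fs <- _]]]|[f fs ->]]; first by exists f.
by exists (ycoef mu f); exact: power_series_rep_ycoef.
Qed.

(** [ycoef mu f] is an admissible family, so [xget] does not fall back on its default, and
    uniqueness identifies its choice. *)
Lemma H2_coef_funrep f : letter_symmetric mu f -> H2_coef (funrep mu f) = ycoef mu f.
Proof.
move=> fs; apply: (@power_series_rep_unique (funrep mu f)); last exact: power_series_rep_ycoef.
apply: (@xgetPex _ _ [set c | power_series_rep mu _ c]); exists (ycoef mu f).
exact: power_series_rep_ycoef.
Qed.

Lemma H2_inner_funrep f g : letter_symmetric mu f -> letter_symmetric mu g ->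
  H2_inner mu (funrep mu f) (funrep mu g) = inner f g.
Proof.
move=> fs gs; rewrite /H2_inner !H2_coef_funrep//.
apply: (cvg_lim (@norm_hausdorff _ _)).
rewrite (_ : partial_sum _ = fun X => inner (partial_sum (fun k => ycoef mu f k *: yvec mu k) X) g).
  by apply: inner_cvgl; exact: ycoef_cvg.
apply/funext => X; rewrite !partial_sumE inner_suml; apply: eq_bigr => k _.
by rewrite innerZl inner_yvec_symmetric// mulrA.
Qed.

Lemma H2_norm_funrep f : letter_symmetric mu f -> H2_norm mu (funrep mu f) = l2norm f.
Proof.
move=> fs; rewrite /H2_norm H2_coef_funrep// coef_sqnorm_ycoef//=.
by rewrite sqrtr_sqr ger0_norm ?l2norm_ge0.
Qed.

(** A Cauchy sequence of functions lifts to a Cauchy sequence of symmetric vectors; it converges in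
    [ell2], and the symmetric vectors form a closed set. *)
Lemma H2_complete : ip_complete (H2 mu) (H2_inner mu).
Proof.
move=> u uH uC.
have [f fP] := @choice _ _ (fun m f => letter_symmetric mu f /\ u m = funrep mu f)
  (fun m => let: ex_intro2 f fs uf := (H2P _).1 (uH m) in ex_intro _ f (conj fs uf)).
have subE g h : letter_symmetric mu g -> letter_symmetric mu h -> H2_inner mu (funrep mu g - funrep mu h)
    (funrep mu g - funrep mu h) = (l2norm (g - h) ^+ 2)%:C.
  move=> gs hs; rewrite -funrepB H2_inner_funrep ?inner_l2norm//;
    exact: submoduleB (submodule_symmetric mu) gs hs.
have ltE (x e : R) : 0 <= x -> 0 < e -> ((x ^+ 2)%:C < (e ^+ 2)%:C) = (x < e).
  by move=> x0 e0; rewrite ltcR ltr_pXn2r// nnegrE ltW.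
have [e e0|g gP] := @ell2_complete _ _ f.
  have [N NP] := uC e e0; exists N => m p Nm Np; have := NP m p Nm Np.
  by rewrite !(fP _).2 subE ?ltE ?l2norm_ge0//; exact: (fP _).1.
have gs : letter_symmetric mu g.
  apply/closure_symmetric/closureP_l2norm => e /gP[N NP].
  exists (f N); first exact: (fP _).1.
  by rewrite -opprB -scaleN1r l2normZ normcN normc1 mul1r NP.
exists (funrep mu g) => [|e e0]; first by apply/H2P; exists g.
have [N NP] := gP e e0; exists N => m Nm.
by rewrite (fP m).2 subE ?ltE ?l2norm_ge0 ?NP//; exact: (fP _).1.
Qed.

Lemma H2_RKHS : is_RKHS (H2 mu) (H2_inner mu) (fock_kernel mu).
Proof.
have [s0 slin] := submodule_symmetric mu.
split.
- split=> [|a phi psi /H2P[f fs ->] /H2P[g gs ->]]; apply/H2P; first by exists 0; rewrite ?funrep0.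
  by exists (a *: f + g); rewrite ?funrep_linear//; exact: slin.
- split.
  + move=> a phi psi chi /H2P[f fs ->] /H2P[g gs ->] /H2P[h hs ->].
    by rewrite -funrep_linear !H2_inner_funrep ?inner_linear//; exact: slin.
  + move=> phi psi /H2P[f fs ->] /H2P[g gs ->].
    by rewrite !H2_inner_funrep// innerC.
  + move=> phi /H2P[f fs ->].
    by rewrite H2_inner_funrep// inner_l2norm ler0c sqr_ge0.
  + move=> phi /H2P[f fs ->]; rewrite H2_inner_funrep// inner_l2norm => -[] /eqP.
    by rewrite sqrf_eq0 => /eqP/l2norm_eq0 ->; exact: funrep0.
- exact: H2_complete.
(* The kernel section at [lam] is by definition the function of [zvec mu lam], which makes the
   reproducing property an instance of [H2_inner_funrep]. *)
- by move=> lam; apply/H2P; exists (zvec mu lam); [exact: zvec_symmetric|].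
- move=> phi lam /H2P[f fs ->].
  exact: esym (H2_inner_funrep fs (@zvec_symmetric _ _ mu lam)).
Qed.

Lemma l2norm_zvec lam : l2norm (zvec mu lam) = Num.sqrt (fine (conv_domain_esum mu (val lam))).
Proof.
rewrite /l2norm; congr (Num.sqrt (fine _)); apply: eq_esum => a _; congr EFin.
rewrite -[zvec mu lam a]/((word_eval _ _)^* / _) normcM normcV normcJ.
by rewrite exprMn exprVn normcC// ltW// bprod_gt0.
Qed.

End hardy_space.

(** * Assembly of the three statements from the description by letter-symmetric vectors *)

Unset Implicit Arguments.

Theorem theorem6p1 (R : realType) (n : nat) (mu : weights R n)
    (mu_nbhs : nbhs (0 : 'rV[R[i]]_n) (conv_domain mu)) :
  (* (i) *)
  (sym_fock mu = closed_span (range (zvec mu)) /\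
   closed_span (range (zvec mu)) =
     orth_compl (closure (ideal_at_vacuum mu))) /\
  (* (ii) *)
  ([/\ forall phi c d, power_series_rep mu phi c -> power_series_rep mu phi d -> c = d,
       set_bij (sym_fock mu) (H2 mu) (funrep mu),
       forall (a : R[i]) (f g : fock R n), sym_fock mu f -> sym_fock mu g ->
         funrep mu (a *: f + g) = a *: funrep mu f + funrep mu g &
       forall f g : fock R n, sym_fock mu f -> sym_fock mu g ->
         H2_inner mu (funrep mu f) (funrep mu g) = inner f g /\
         H2_norm mu (funrep mu f) = l2norm f] /\
   [/\ forall f : fock R n, sym_fock mu f -> exists c : {ffun 'I_n -> nat} -> R[i],
         partial_sum (fun k => c k *: yvec mu k) @ totally --> f,
       forall (f : fock R n) (c : {ffun 'I_n -> nat} -> R[i]), sym_fock mu f ->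
         partial_sum (fun k => c k *: yvec mu k) @ totally --> f ->
         power_series_rep mu (funrep mu f) c /\
         coef_sqnorm mu c = ((l2norm f) ^+ 2)%:E &
       forall (f : fock R n) (lam : conv_domain mu), sym_fock mu f ->
         normc (funrep mu f lam) <=
           l2norm f * Num.sqrt (fine (conv_domain_esum mu (val lam)))]) /\
  (* (iii) *)
  ((forall phi, H2 mu phi -> H2_inner mu phi phi = ((H2_norm mu phi) ^+ 2)%:C) /\
   is_RKHS (H2 mu) (H2_inner mu) (fock_kernel mu) /\
   forall zeta lam : conv_domain mu,
     partial_sum (fun b => (bprod mu b ^+ 2)^-1%:C *
       word_eval (val zeta) b * (word_eval (val lam) b)^*) @ totally -->
     fock_kernel mu zeta lam).
Proof.
have symE := sym_fockE mu_nbhs.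
split; first by rewrite orth_compl_closure symE closed_span_zvecE// orth_idealE.
rewrite symE; split; last first.
  split=> [phi /H2P[f fs ->]|]; first by rewrite H2_inner_funrep// H2_norm_funrep// inner_l2norm.
  split=> [|zeta lam]; first exact: H2_RKHS.
  (* The series of the kernel is the one defining the inner product of the two z vectors, with the
     two weights collected into a square. *)
  rewrite (_ : (fun b => _) = fun b => zvec mu lam b * (zvec mu zeta b)^*).
    exact: inner_cvg.
  apply/funext => b; rewrite conj_zvec -[zvec mu lam b]/((word_eval _ _)^* / _).
  by rewrite realCV expr2 realCM; field; rewrite bprodC_neq0.
split.
  split.
  - exact: power_series_rep_unique.
  - split=> [f fs|f g fs gs|phi /H2P[f fs ->]]; [|exact: funrep_inj|by exists f].
    by apply/H2P => //; exists f.
  - by move=> a f g _ _; exact: funrep_linear.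
  - by move=> f g fs gs; rewrite H2_inner_funrep// H2_norm_funrep.
split.
- by move=> f fs; exists (ycoef mu f); exact: ycoef_cvg.
- move=> f c fs /(ycoef_unique fs) ->.
  by split; [exact: power_series_rep_ycoef|exact: coef_sqnorm_ycoef].
- move=> f lam _; rewrite -l2norm_zvec; exact: normc_inner_le.
Qed.
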